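(* Let $p$ be an odd prime and let $G$, with its closed normal subgroups $Z\le H$, be the pro-$p$ group defined in the context. Let $m,n\in\mathbb{N}$ with $m\ge\max\{2,n-1\}$ and $n\ge2$. Let $\mathcal{S}$ be a filtration series of $G$ such that $\mathrm{hdim}^{\mathcal{S}}_G(H)=1$ and $\mathrm{hdim}^{\mathcal{S}}_G(Z)=\tfrac1n$. Then \[ \mathrm{hspec}^{\mathcal{S}^{(m)}}_{\trianglelefteq}(G^{(m)})=\Big[0,\tfrac{mn-(n-1)^2}{mn}\Big]\cup\bigcup_{m-n+2\le l\le m-1}\Big[\tfrac{l}{m},\tfrac{m+l(n-1)}{mn}\Big]\cup\{1\} \] consists of $n$ disjoint intervals (where $\{1\}$ is counted as a degenerate interval).
   Context: Hausdorff dimension. A filtration series $\mathcal{S}$ of a countably based infinite pro-$p$ group $\Gamma$ is a descending chain $\Gamma=\Gamma_0\supseteq\Gamma_1\supseteq\cdots$ of open normal subgroups with $\bigcap_i\Gamma_i=1$. For a closed subgroup $K\le\Gamma$, $\mathrm{hdim}^{\mathcal{S}}_\Gamma(K)=\liminf_{i\to\infty}\frac{\log_p|K\Gamma_i:\Gamma_i|}{\log_p|\Gamma:\Gamma_i|}$, and $\mathrm{hspec}^{\mathcal{S}}_{\trianglelefteq}(\Gamma)=\{\mathrm{hdim}^{\mathcal{S}}_\Gamma(K)\mid K\text{ a closed normal subgroup of }\Gamma\}$. The group. Let $W=C_p\mathrel{\hat{\wr}}\mathbb{Z}_p=\varprojlim_k C_p\wr C_{p^k}=\langle x,y\rangle=\langle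 x\rangle\ltimes B$, with top group $\langle x\rangle\cong\mathbb{Z}_p$ and base group $B\cong C_p^{\aleph_0}$, the closed subgroup generated by all $y^{x^i}$, $i\in\mathbb{Z}$ (concretely $W\cong\langle 1+t\rangle\ltimes\mathbb{F}_p[\![t]\!]$, where $x$ corresponds to $1+t$ acting by multiplication, $y$ to $1\in\mathbb{F}_p[\![t]\!]$ and $B$ to $\mathbb{F}_p[\![t]\!]$). Let $F=\langle x,y\rangle$ be the free pro-$p$ group on $x,y$, let $R$ be the kernel of the epimorphism $F\to W$ sending $x,y$ to the generators of the same name, and let $N=[R,F]R^p$ (closed subgroup). Put $G=F/N$, $Z=R/N$, and let $H$ be the preimage of $B$ under the projection $G\to G/Z\cong W$, i.e. the closed subgroup generated by $Z$ and all $y^{x^i}$, $i\in\mathbb{Z}$. Direct powers. $G^{(m)}=G\times\overset{m}{\cdots}\times G$, and for $\mathcal{S}\colon G=S_0\supseteq S_1\supseteq\cdots$, the product filtration series $\mathcal{S}^{(m)}$ of $G^{(m)}$ is $S_i\times\overset{m}{\cdots}\times S_i$, $i\ge0$. *)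

(* Defs.v *)
From HB Require Import structures.
From mathcomp Require Import all_boot all_order all_algebra.
From mathcomp Require Import finmap.
From mathcomp Require Import all_classical all_reals all_analysis.

Set Implicit Arguments.
Unset Strict Implicit.
Unset Printing Implicit Defensive.
Import Order.TTheory GRing.Theory Num.Theory.
Local Open Scope classical_set_scope.
Local Open Scope group_scope.

HB.mixin Record isTopologicalGroup G & Group G & Topological G := {
  mulg_continuous : continuous (fun z : G * G => z.1 * z.2);
  invg_continuous : continuous (fun z : G => z^-1)
}.

#[short(type="topologicalGroupType")]
HB.structure Definition TopologicalGroup :=
  {G of isTopologicalGroup G & Group G & Topological G}.

Definition gprod (I : eqType) (T : I -> topologicalGroupType) : Type :=
  prod_topology T.

Section gprod.
Variables (I : eqType) (T : I -> topologicalGroupType).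
HB.instance Definition _ := Topological.copy (gprod T) (prod_topology T).

Let mulp (f g : gprod T) : gprod T := fun i => f i * g i.
Let onep : gprod T := fun i => 1.
Let invp (f : gprod T) : gprod T := fun i => (f i)^-1.

Let mulpA : associative mulp.
Proof.
by move=> f g h; apply/functional_extensionality_dep => i; exact: mulgA.
Qed.

Let mul1p : left_id onep mulp.
Proof. by move=> f; apply/functional_extensionality_dep => i; exact: mul1g. Qed.

Let mulp1 : right_id onep mulp.
Proof. by move=> f; apply/functional_extensionality_dep => i; exact: mulg1. Qed.

Let mulVp : left_inverse onep invp mulp.
Proof. by move=> f; apply/functional_extensionality_dep => i; exact: mulVg. Qed.

Let mulpV : right_inverse onep invp mulp.
Proof. by move=> f; apply/functional_extensionality_dep => i; exact: mulgV. Qed.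

HB.instance Definition _ :=
  isGroup.Build (gprod T) mulpA mul1p mulp1 mulVp mulpV.

Lemma gprod_proj_continuous (i : I) :
  continuous ((fun f => f i) : gprod T -> T i).
Proof. exact: (@proj_continuous I T i). Qed.

Lemma gprod_continuous (X : topologicalType) (h : X -> gprod T) :
  (forall i, continuous (fun x => h x i)) -> continuous h.
Proof.
move=> hc x; apply/cvg_sup => i; move: x.
apply/(@continuousP _ (initial_topology (fun f : forall i, T i => f i))).
move=> A [B Bo <-].
by move/continuousP: (hc i) => /(_ B Bo).
Qed.

Let mulp_continuous : continuous (fun z : gprod T * gprod T => z.1 * z.2).
Proof.
apply: gprod_continuous => i z.
apply: (@continuous_comp _ _ _ (fun w : gprod T * gprod T => (w.1 i, w.2 i))
  (fun w : T i * T i => w.1 * w.2)).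
  apply: cvg_pair => /=.
    apply: (@continuous_comp _ _ _ (fun w : gprod T * gprod T => w.1)
      (fun f : gprod T => f i)); first exact: cvg_fst.
    exact: gprod_proj_continuous.
  apply: (@continuous_comp _ _ _ (fun w : gprod T * gprod T => w.2)
    (fun f : gprod T => f i)); first exact: cvg_snd.
  exact: gprod_proj_continuous.
exact: mulg_continuous.
Qed.

Let invp_continuous : continuous (fun z : gprod T => z^-1).
Proof.
apply: gprod_continuous => i z.
apply: (@continuous_comp _ _ _ (fun f : gprod T => f i) (fun w => w^-1)).
  exact: gprod_proj_continuous.
exact: invg_continuous.
Qed.

HB.instance Definition _ :=
  isTopologicalGroup.Build (gprod T) mulp_continuous invp_continuous.
End gprod.

Section Subgroups.
Variable G : topologicalGroupType.
Implicit Types (A B K S : set G).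

Definition is_subgroup K :=
  K 1 /\ forall a b, K a -> K b -> K (a * b^-1).

Definition is_normal K :=
  is_subgroup K /\ forall a b, K a -> K (a ^ b).

Definition closed_gen A : set G :=
  \bigcap_(K in [set K | [/\ is_subgroup K, closed K & A `<=` K]]) K.

Definition setmul A B : set G := [set a * b | a in A & b in B].

(* |A : S| as the number of left cosets a * S with a in A; the value is 0 when
   there are infinitely many. *)
Definition index A S : nat :=
  #|` fset_set [set setmul [set a] S | a in A]|.

Definition filtration_series (S : nat -> set G) :=
  [/\ S 0%N = setT,
      forall i, S i.+1 `<=` S i,
      forall i, open (S i) /\ is_normal (S i)
    & \bigcap_i S i = [set 1]].

End Subgroups.

Section Homomorphisms.
Variables F G : topologicalGroupType.

Definition continuous_hom (f : F -> G) :=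
  continuous f /\ {morph f : a b / a * b >-> a * b}.

Definition ker (f : F -> G) : set F := f @^-1` [set 1].

(* G, together with q : F -> G, is the topological quotient group F / N. *)
Definition is_quotient (N : set F) (q : F -> G) :=
  [/\ {morph q : a b / a * b >-> a * b}, q @` setT = setT, ker q = N
    & forall U : set G, open U <-> open (q @^-1` U)].

End Homomorphisms.

Definition pro_p (p : nat) (G : topologicalGroupType) :=
  [/\ compact [set: G],
      hausdorff_space G,
      (forall U : set G, nbhs 1 U ->
        exists2 K : set G, open K /\ is_subgroup K & K `<=` U)
    & forall K : set G, open K -> is_normal K ->
        exists k, index setT K = (p ^ k)%N].

Definition free_pro_p2 (p : nat) (F : topologicalGroupType) (x y : F) :=
  pro_p p F /\
  forall (P : topologicalGroupType) (a b : P), pro_p p P ->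
    exists! f : F -> P, [/\ continuous_hom f, f x = a & f y = b].

(* The wreath product C_a wr C_b (for a, b >= 2), with the discrete topology.
   The pair (c, f) stands for s ^ c * f, where s generates the top group and
   f : 'Z_b -> 'Z_a is an element of the base group; conjugation by s shifts f
   by one, that is (f ^ s) j = f (j - 1). *)
Definition wreath (a b : nat) : Type := ('Z_b * {ffun 'Z_b -> 'Z_a})%type.

Section wreath.
Variables a b : nat.
HB.instance Definition _ := Choice.copy (wreath a b)
  ('Z_b * {ffun 'Z_b -> 'Z_a})%type.
HB.instance Definition _ := Topological.copy (wreath a b)
  (discrete_topology ('Z_b * {ffun 'Z_b -> 'Z_a})%type).

Local Open Scope ring_scope.
Let mulw (u v : wreath a b) : wreath a b :=
  (u.1 + v.1, [ffun j => u.2 (j - v.1) + v.2 j]).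
Let onew : wreath a b := (0, [ffun=> 0]).
Let invw (u : wreath a b) : wreath a b := (- u.1, [ffun j => - u.2 (j + u.1)]).

Let mulwA : associative mulw.
Proof.
move=> u v w; rewrite /mulw /= addrA; congr pair; apply/ffunP => j.
by rewrite !ffunE /= opprD (addrAC j) -addrA addrA (addrA (u.2 _)).
Qed.

Let mul1w : left_id onew mulw.
Proof.
move=> [c f]; rewrite /mulw /= add0r; congr pair.
by apply/ffunP => j; rewrite !ffunE add0r.
Qed.

Let mulw1 : right_id onew mulw.
Proof.
move=> [c f]; rewrite /mulw /= addr0; congr pair.
by apply/ffunP => j; rewrite !ffunE subr0 addr0.
Qed.

Let mulVw : left_inverse onew invw mulw.
Proof.
move=> [c f]; rewrite /mulw /= addNr; congr pair.
by apply/ffunP => j; rewrite !ffunE subrK addNr.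
Qed.

Let mulwV : right_inverse onew invw mulw.
Proof.
move=> [c f]; rewrite /mulw /= addrN; congr pair.
by apply/ffunP => j; rewrite !ffunE opprK addrN.
Qed.

HB.instance Definition _ :=
  isGroup.Build (wreath a b) mulwA mul1w mulw1 mulVw mulwV.

Lemma wreath_nbhs1 (u : wreath a b) : nbhs u [set u].
Proof.
exact: (discrete_set1 (u : discrete_topology ('Z_b * {ffun 'Z_b -> 'Z_a})%type)).
Qed.

Let mulw_continuous :
  continuous (fun z : wreath a b * wreath a b => (z.1 * z.2)%g).
Proof.
move=> z U /nbhs_singleton Uz.
exists ([set z.1], [set z.2]); first by split; exact: wreath_nbhs1.
by case=> z1 z2 /= [-> ->].
Qed.

Let invw_continuous : continuous (fun z : wreath a b => (z^-1)%g).
Proof.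
move=> z U /nbhs_singleton Uz.
have sub : [set z] `<=` (fun v : wreath a b => (v^-1)%g) @^-1` U by move=> _ ->.
exact: (filterS sub (@wreath_nbhs1 z)).
Qed.

HB.instance Definition _ :=
  isTopologicalGroup.Build (wreath a b) mulw_continuous invw_continuous.

Definition wreath_top : wreath a b := (1, [ffun=> 0]).
Definition wreath_base : wreath a b := (0, [ffun j => (j == 0)%:R]).
End wreath.

(* For c dividing b, the reduction C_a wr C_b -> C_a wr C_c induced by
   'Z_b -> 'Z_c, which sends the base generator at i to the one at i mod c. *)
Definition wreath_red (a b c : nat) (u : wreath a b) : wreath a c :=
  ((u.1 : nat)%:R, [ffun j => \sum_(i : 'Z_b | (i : nat)%:R == j) u.2 i])%R.

Section W.
Variable p : nat.

(* The levels are the C_p wr C_(p ^ k) with k >= 1: 'Z_1 is not trivial, and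
   dropping k = 0 does not change the inverse limit. *)
Definition wreath_tower (k : nat) : topologicalGroupType :=
  wreath p (p ^ k.+1).

Definition W : set (gprod wreath_tower) :=
  [set w | forall k, wreath_red (p ^ k.+1) (w k.+1) = w k].

Definition Wx : gprod wreath_tower := fun k => wreath_top p (p ^ k.+1).
Definition Wy : gprod wreath_tower := fun k => wreath_base p (p ^ k.+1).

Definition WB : set (gprod wreath_tower) :=
  closed_gen (range (fun i => Wy ^ (Wx ^+ i)) `|`
              range (fun i => Wy ^ (Wx ^- i))).

End W.
Arguments W : clear implicits.
Arguments Wx : clear implicits.
Arguments Wy : clear implicits.
Arguments WB : clear implicits.

Section G.
Variables (p : nat) (F G : topologicalGroupType).
Variables (phi : F -> gprod (wreath_tower p)) (q : F -> G).

(* With R = ker phi: the closed subgroup N = [R,F]R^p of F. *)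
Definition Nsub : set F :=
  closed_gen ([set [~ r, f] | r in ker phi & f in setT] `|`
              [set r ^+ p | r in ker phi]).

Definition Zsub : set G := q @` ker phi.

(* phi induces G = F / N -> W, and the preimage of the base group under this
   map is the image in G of phi @^-1` WB. *)
Definition Hsub : set G := q @` (phi @^-1` WB p).

End G.

Definition gpow (G : topologicalGroupType) (m : nat) : topologicalGroupType :=
  gprod (fun _ : 'I_m => G).

Definition filtration_pow (G : topologicalGroupType) (S : nat -> set G)
    (m : nat) : nat -> set (gpow G m) :=
  fun i => [set g | forall j : 'I_m, S i (g j)].
Arguments filtration_pow {G} S m.

Section hdim.
Variables (R : realType) (p : nat) (G : topologicalGroupType).
Variable S : nat -> set G.
Local Open Scope ring_scope.

Definition logp (x : R) : R := ln x / ln p%:R.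

(* Where S i = G (such as i = 0) the quotient is 0 / 0 = 0; for infinite G this
   happens for finitely many i and does not affect the limit inferior. *)
Definition hdim (K : set G) : R :=
  limn_inf (fun i => logp (index (setmul K (S i)) (S i))%:R
                     / logp (index setT (S i))%:R).

Definition hspec_normal : set R :=
  [set hdim K | K in [set K | closed K /\ is_normal K]].

End hdim.
Arguments hspec_normal : clear implicits.
Arguments hspec_normal R p {G} S.

Section intervals.
Variables (R : realType) (m n : nat).
Local Open Scope ring_scope.

Definition low_interval : set R :=
  `[0, (m%:R * n%:R - (n%:R - 1) ^+ 2) / (m%:R * n%:R)].

Definition mid_interval (l : nat) : set R :=
  `[l%:R / m%:R, (m%:R + l%:R * (n%:R - 1)) / (m%:R * n%:R)].

(* m - n + 2 <= l <= m - 1; the left-hand inequality is rearranged because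
   m - n is -1 when m = n - 1, whereas subtraction in nat is truncated. *)
Definition mid_range : set nat := [set l | (m + 2 <= l + n)%N && (l <= m - 1)%N].

Definition interval_family : set (set R) :=
  [set low_interval] `|` (mid_interval @` mid_range) `|` [set [set 1]].

End intervals.
Arguments low_interval : clear implicits.
Arguments mid_interval : clear implicits.
Arguments interval_family : clear implicits.

(* Main.v *)
(* Let K be a normal subgroup of G^m and let l be the number of coordinates j at
   which the projection K_j of K is not inside Z. For such a j, K contains
   [K_j, G] in the coordinate j, and [K_j, G] contains a subgroup of finite index
   of H. Indeed, let H_0 = H and H_(k+1) = [H_k, G]. Since x has infinite order
   modulo H, H is generated by y modulo [H, G]. As y centralises H modulo Z, the
   steps H_k Z / H_(k+1) Z have order at most p. Hence a normal subgroup of G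
   inside H but not inside Z covers one of these steps, and by nilpotency of the
   finite quotients it then contains H_(k+1) for some k; finally, all the steps
   H_k / H_(k+1) are finite. In the quotients by S_i this gives, with a constant C
   that does not depend on i,
     l log|H S_i : S_i| - C <= log|K S_i^m : S_i^m|
                            <= l log|G : S_i| + (m - l) log|Z S_i : S_i|,
   so that the Hausdorff dimension of K lies in [l/m, l/m + (m - l)/(m n)].
   Conversely, Z is central and elementary abelian, so for each c in [0, 1] it has
   a closed subgroup L with log_p|L S_i : S_i| = floor(c log_p|Z S_i : S_i|) for all
   i, and the groups G^l * L^(m - l) realise every value in that interval. The
   intervals with l <= m - n + 1 overlap and form the first interval. *)
From HB Require Import structures.
Require Import Defs.
From mathcomp Require Import all_boot all_order all_algebra all_fingroup all_solvable.

Set Implicit Arguments.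
Unset Strict Implicit.
Unset Printing Implicit Defensive.

(** * Lower series in finite p-groups *)

(** The constant [C] must not depend on [i], while the commutator argument takes place in the finite
    groups [G / S i]. One auxiliary quotient makes it uniform: a commutator [[~ a, g]] with [a] in
    [K] that lies outside [Z] survives in some [C_p wr C_(p ^ k.+1)], and nilpotency there fixes a
    depth [c]. Once [S i] lies in the kernel of the map to that wreath product, the same commutator
    keeps the image of [[K, G]] outside [H_c Z]. The loss is then at most [|H : H_c|], which [p] and
    [c] bound: [G] has two generators, so each step of the series is at most the square of the
    preceding one. That such a commutator exists expresses the triviality of the centre of [W],
    although every finite level has a nontrivial centre. That [x] and [y] generate [G] topologically
    comes from the uniqueness half of the universal property of [F]. The subgroup [L] is built one
    [S i] at a time, and compactness keeps its indices right in the limit. *)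

Section FiniteGroups.
Local Open Scope group_scope.

(** Since [[~: N, G]] is central, [n |-> [~ n, g]] is a homomorphism on [N] that kills [[~: N, G]],
    so its image has at most [#|N : [~: N, G]|] elements. The images for [x] and [y] already
    generate [[~: N, G]], because the [g] whose commutators with [N] lie in a given central subgroup
    form a group. *)
Lemma card_commg_central (gT : finGroupType) (G N : {group gT}) (x y : gT) :
  N <| G -> G \subset <<[set x; y]>> -> x \in G -> y \in G ->
  [~: [~: N, G], G] = 1 ->
  (#|[~: N, G]| <= #|N : [~: N, G]| ^ 2)%N /\
  ({in N, forall n, [~ n, y] = 1} -> #|[~: N, G]| <= #|N : [~: N, G]|).
Proof.
move=> nNG gG xG yG cM.
have sMN : [~: N, G] \subset N by rewrite commg_subl normal_norm.
have sNG := normal_sub nNG.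
have cMG : [~: N, G] \subset 'C(G) by exact/commG1P.
have fM g : g \in G -> {in N &, {morph (fun n => [~ n, g]) : a b / a * b}}.
  move=> gG' a b aN bN /=; rewrite commMgJ; congr (_ * _).
  apply/conjg_fixP/commgP.
  by apply: (centP (subsetP cMG _ (mem_commg aN gG'))); exact: (subsetP sNG).
pose f g (gG' : g \in G) := Morphism (fM g gG').
have card_f g (gG' : g \in G) : #|f g gG' @* N| <= #|N : [~: N, G]|.
  rewrite card_morphim setIid; apply: dvdn_leq; first exact: indexg_gt0.
  apply/indexgS/subsetP => a aM.
  rewrite !inE /= (subsetP sMN) //=; apply/eqP/eqP/commgP.
  by apply: (centP (subsetP cMG _ aM)).
have cA g (gG' : g \in G) : f g gG' @* N \subset 'C(G).
  by apply/subset_trans: cMG; apply/subsetP=> _ /morphimP[a aN _ ->] /=; exact: mem_commg.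
have AB : f x xG @* N * f y yG @* N = f x xG @* N <*> f y yG @* N.
  symmetry; rewrite cent_joinEr //; apply: subset_trans (cA _ _) (centS _).
  by apply/subsetP=> _ /morphimP[a aN _ ->] /=; rewrite groupR // (subsetP sNG).
have MAB : [~: N, G] \subset f x xG @* N * f y yG @* N.
  rewrite AB; set A := _ <*> _.
  have cAG : A \subset 'C(G) by rewrite join_subG !cA.
  pose T := [set g in G | [forall n in N, [~ n, g] \in A]].
  have grpT : group_set T.
    apply/group_setP; split.
      by rewrite inE group1; apply/forall_inP=> n nN; rewrite commg1 group1.
    move=> a b; rewrite !inE => /andP[aG /forall_inP ha] /andP[bG /forall_inP hb].
    rewrite groupM //=; apply/forall_inP=> n nN.
    rewrite commgMJ groupM ?hb // memJ_norm ?ha //.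
    by rewrite (subsetP _ _ bG) // cents_norm // centsC.
  have sGT : G \subset Group grpT.
    apply: subset_trans gG _; rewrite gen_subG.
    apply/subsetP=> g; rewrite !inE => /orP[] /eqP->; rewrite ?xG ?yG /=;
      apply/forall_inP=> n nN; apply: mem_gen; rewrite inE; apply/orP.
      by left; apply/morphimP; exists n.
    by right; apply/morphimP; exists n.
  rewrite gen_subG; apply/subsetP=> _ /imset2P[n g nN gG' ->].
  by move: (subsetP sGT g gG'); rewrite inE => /andP[_ /forall_inP]; apply.
have leM : #|[~: N, G]| <= #|f x xG @* N| * #|f y yG @* N|.
  apply: leq_trans (subset_leq_card MAB) _.
  by rewrite mul_cardG leq_pmulr ?cardG_gt0.
split; first by rewrite (leq_trans leM) // -mulnn leq_mul.
move=> y1; have f1 : f y yG @* N = 1.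
  by apply/trivgP/subsetP=> _ /morphimP[n nN _ ->] /=; rewrite y1 // inE.
by apply: leq_trans leM _; rewrite f1 cards1 muln1.
Qed.

Lemma normal_commg (gT : finGroupType) (G N : {group gT}) :
  N <| G -> [~: N, G] <| G.
Proof.
case/andP=> sNG nNG; rewrite /normal commg_normr andbT.
by rewrite (subset_trans _ sNG) // commg_subl.
Qed.

Lemma index_commg (gT : finGroupType) (G N : {group gT}) (x y : gT) :
  N <| G -> G \subset <<[set x; y]>> -> x \in G -> y \in G ->
  (#|[~: N, G] : [~: [~: N, G], G]| <= #|N : [~: N, G]| ^ 2)%N /\
  ({in N, forall n, [~ n, y] = 1} ->
   #|[~: N, G] : [~: [~: N, G], G]| <= #|N : [~: N, G]|).
Proof.
move=> nNG gG xG yG; set M := [~: N, G]; set P := [~: M, G].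
have nMG : M <| G := normal_commg nNG.
have nPG : G \subset 'N(P) by exact: commg_normr.
have sMN : M \subset N by rewrite commg_subl normal_norm.
have sPM : P \subset M by rewrite commg_subl normal_norm.
have nPN : N \subset 'N(P) := subset_trans (normal_sub nNG) nPG.
have nPM : M \subset 'N(P) := subset_trans sMN nPN.
have MP : M / P = [~: N / P, G / P] by rewrite quotientR.
have cP : [~: [~: N / P, G / P], G / P] = 1.
  by rewrite -MP -quotientR // trivg_quotient.
have gGP : G / P \subset <<[set coset P x; coset P y]>>.
  rewrite (subset_trans (quotientS P gG)) // quotient_gen; last first.
    by apply/subsetP=> g /set2P[]->; exact: (subsetP nPG).
  by rewrite /quotient morphimU !morphim_set1 ?(subsetP nPG).
have [h1 h2] := card_commg_central (quotient_normal P nNG) gGP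
  (mem_quotient P xG) (mem_quotient P yG) cP.
have e1 : #|[~: N / P, G / P]| = #|M : P| by rewrite -MP card_quotient.
have e2 : #|N / P : [~: N / P, G / P]| = #|N : M|.
  rewrite -MP index_quotient_eq //; exact: subset_trans (subsetIr _ _) sPM.
rewrite e1 e2 in h1 h2; split=> // y1; apply: h2 => _ /morphimP[n nn nN ->].
by rewrite -morphR ?y1 ?morph1 //; exact: (subsetP nPG).
Qed.

Definition lower_series (gT : finGroupType) (H G : {group gT}) (k : nat) :
  {group gT} := iter k (fun M : {group gT} => [~: M, G]%G) H.

Lemma lower_series_normal (gT : finGroupType) (H G : {group gT}) (k : nat) :
  H <| G -> lower_series H G k <| G.
Proof.
by move=> nHG; elim: k => //= k; exact: normal_commg.
Qed.

Lemma lower_seriesS (gT : finGroupType) (H G : {group gT}) (k : nat) :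
  H <| G -> lower_series H G k.+1 \subset lower_series H G k.
Proof.
by move=> nHG; rewrite /= commg_subl; case/andP: (lower_series_normal k nHG).
Qed.

Lemma lower_series_sub (gT : finGroupType) (H G : {group gT}) (j k : nat) :
  H <| G -> j <= k -> lower_series H G k \subset lower_series H G j.
Proof.
move=> nHG /subnK <-; elim: (k - j)%N => // d; apply: subset_trans.
by rewrite addSn lower_seriesS.
Qed.

Lemma morphim_lower_series (aT rT : finGroupType) (D : {group aT})
    (f : {morphism D >-> rT}) (H G : {group aT}) (k : nat) :
  H <| G -> G \subset D ->
  f @* lower_series H G k = lower_series (f @* H)%G (f @* G)%G k.
Proof.
move=> nHG sGD; elim: k => //= k <-; rewrite morphimR //.
exact: subset_trans (normal_sub (lower_series_normal k nHG)) sGD.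
Qed.

Lemma lower_series_nil (gT : finGroupType) (H G : {group gT}) :
  nilpotent G -> H <| G -> exists k, lower_series H G k :=: 1.
Proof.
move=> /lcnP[k L1] nHG; exists k.
suff s : lower_series H G k \subset 'L_k.+1(G).
  by apply/trivgP; rewrite -L1.
elim: {L1} k => [|k ih] /=; first by rewrite lcn1 normal_sub.
by rewrite lcnSn commSg.
Qed.

(** The first bound serves in [G / S i] itself, where [y] need not centralise the base; the second
    serves modulo [Z], where it does, and there the steps do not grow. *)
Lemma index_lower_series (gT : finGroupType) (H G : {group gT}) (x y : gT) (k : nat) :
  H <| G -> G \subset <<[set x; y]>> -> x \in G -> y \in G ->
  (#|lower_series H G k : lower_series H G k.+1|
     <= #|H : [~: H, G]| ^ (2 ^ k))%N /\
  ({in H, forall h, [~ h, y] = 1} ->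
   #|lower_series H G k : lower_series H G k.+1| <= #|H : [~: H, G]|).
Proof.
move=> nHG gG xG yG; elim: k => [|k [ih1 ih2]]; first by rewrite expn0 expn1.
have [h1 h2] := index_commg (lower_series_normal k nHG) gG xG yG.
split; first by rewrite (leq_trans h1) // [(2 ^ k.+1)%N]expnSr expnM leq_exp2r.
move=> y1; apply: leq_trans (h2 _) (ih2 y1) => h hL; apply: y1.
exact: (subsetP (lower_series_sub nHG (leq0n k))).
Qed.

(** The factor depends on the group only through [#|H : [~: H, G]|], hence it can be bounded
    uniformly over all finite quotients. *)
Lemma card_lower_series (gT : finGroupType) (H G : {group gT}) (x y : gT) (c : nat) :
  H <| G -> G \subset <<[set x; y]>> -> x \in G -> y \in G ->
  (#|H| <= #|lower_series H G c| * \prod_(k < c) #|H : [~: H, G]| ^ (2 ^ k))%N.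
Proof.
move=> nHG gG xG yG; elim: c => [|c ih]; first by rewrite big_ord0 muln1.
rewrite big_ord_recr /= mulnCA (leq_trans ih) // mulnC leq_mul2l; apply/orP; right.
rewrite -(Lagrange (lower_seriesS c nHG)) leq_mul2l; apply/orP; right.
by have [] := index_lower_series c nHG gG xG yG.
Qed.

Lemma index_mul_cycle (gT : finGroupType) (H K : {group gT}) (y : gT) :
  K \subset H -> H \subset K * <[y]> -> #|H : K| <= #[y].
Proof.
move=> sKH sH; rewrite -(leq_pmul2l (cardG_gt0 K)) Lagrange //.
apply: leq_trans (subset_leq_card sH) _.
by rewrite orderE mul_cardG leq_pmulr ?cardG_gt0.
Qed.

(* [K] first leaves the series modulo [Z] at a step of index [p], which it
   therefore covers; commuting with [G] pushes this down the series, and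
   nilpotency removes the error term. *)
Lemma lower_series_sub_normal (gT : finGroupType) (p : nat) (G H Z K : {group gT})
    (x y : gT) (c : nat) :
  prime p -> p.-group G -> G \subset <<[set x; y]>> -> x \in G -> y \in G ->
  H <| G -> Z \subset 'Z(G) -> H \subset [~: H, G] * <[y]> ->
  {in H, forall h, [~ h, y] \in Z} -> y ^+ p \in Z ->
  K <| G -> K \subset H -> ~~ (K \subset lower_series H G c * Z) ->
  lower_series H G c \subset K.
Proof.
move=> pp pG gG xG yG nHG sZ sH hZ ypZ nKG sKH nK.
have nZG : Z <| G := sub_center_normal sZ.
have nZ := normal_norm nZG.
pose L := lower_series H G.
have nL k : L k <| G := lower_series_normal k nHG.
have Lq k : L k / Z = lower_series (H / Z)%G (G / Z)%G k.
  exact: morphim_lower_series.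
have gGq : G / Z \subset <<[set coset Z x; coset Z y]>>.
  rewrite (subset_trans (quotientS Z gG)) // quotient_gen; last first.
    by apply/subsetP=> g /set2P[]->; exact: (subsetP nZ).
  by rewrite /quotient morphimU !morphim_set1 ?(subsetP nZ).
have sHq : H / Z \subset [~: H / Z, G / Z] * <[coset Z y]>.
  rewrite -quotientR ?(subset_trans (normal_sub nHG)) //.
  rewrite -quotient_cycle ?(subsetP nZ) // -quotientMr ?quotientS //.
  by rewrite cycle_subG (subsetP nZ).
have iH : #|H / Z : [~: H / Z, G / Z]| <= p.
  apply: leq_trans (index_mul_cycle _ sHq) _;
    first by rewrite commg_subl quotient_norms // normal_norm.
  apply: dvdn_leq (prime_gt0 pp) _; rewrite order_dvdn -morphX ?(subsetP nZ) //.
  by apply/eqP; exact: coset_id.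
have y1 : {in H / Z, forall h, [~ h, coset Z y] = 1}.
  move=> _ /morphimP[h nh hH ->]; have hG := subsetP (normal_sub nHG) _ hH.
  by rewrite -morphR ?(subsetP nZ) //; exact/coset_id/hZ.
have iL k : #|L k / Z : L k.+1 / Z| <= p.
  rewrite !Lq; have [_ le1] := index_lower_series k (quotient_normal Z nHG)
    gGq (mem_quotient Z xG) (mem_quotient Z yG).
  exact: leq_trans (le1 y1) iH.
have [k kc [sK nK1]] : exists2 k, k < c & K \subset L k * Z /\ ~~ (K \subset L k.+1 * Z).
  elim: c nK => [|c ih] nK.
    by case/negP: nK; apply: subset_trans sKH (mulG_subl _ _).
  case: (boolP (K \subset L c * Z)) => [s|/ih[k kc ?]]; first by exists c.
  by exists k; first exact: ltnW.
have nZL j : L j \subset 'N(Z) := subset_trans (normal_sub (nL j)) nZ.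
have nZK : K \subset 'N(Z) := subset_trans (normal_sub nKG) nZ.
have sub_q (A B : {group gT}) : A \subset 'N(Z) -> B \subset 'N(Z) ->
    (A / Z \subset B / Z) = (A \subset B * Z).
  by move=> nA nB; rewrite quotientSK // -(normC nB).
pose A : {group _} := (L k.+1 / Z)%G; pose J := (A <*> (K / Z))%G.
have sJ : J \subset L k / Z.
  by rewrite join_subG quotientS ?lower_seriesS //= sub_q.
(* [#|J : A|] is a power of [p] other than 1, hence at least [p]; a further index of 2 or more would
   exceed [iL k]. *)
have cov : L k / Z \subset J.
  rewrite -indexg_eq1 eqn_leq indexg_gt0 andbT -ltnS.
  have J1 : 1 < #|J : A| by rewrite indexg_gt1 join_subG subxx /= (sub_q K (L k.+1)).
  have pJ : p <= #|J : A|.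
    have pJA : p.-nat #|J : A|.
      apply: pnat_dvd (dvdn_indexg _ _) _; apply: pgroupS sJ _.
      exact/quotient_pgroup/(pgroupS (normal_sub (nL k))).
    case/p_natP: pJA J1 => [[|e] ->] // _.
    by rewrite expnS leq_pmulr // expn_gt0 prime_gt0.
  rewrite ltnNge; apply/negP => J2.
  have := iL k; rewrite leqNgt => /negP[].
  rewrite -(Lagrange_index sJ (joing_subl _ _)) mulnC.
  apply: leq_trans (leq_mul pJ J2); rewrite muln2 -addnn -[X in X < _]addn0.
  by rewrite ltn_add2l prime_gt0.
have LK : L k \subset L k.+1 * K * Z.
  have nLK : L k.+1 <*> K \subset 'N(Z) by rewrite join_subG nZL.
  have : L k / Z \subset (L k.+1 <*> K) / Z.
    by rewrite (subset_trans cov) // join_subG !quotientS ?joing_subl ?joing_subr.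
  rewrite sub_q //= norm_joinEr //.
  exact: subset_trans (normal_sub nKG) (normal_norm (nL k.+1)).
have nG (M : {group gT}) : M <| G -> G \subset 'N(M) by case/andP.
(* Write an element of [L k] as [a * b * z] by [LK]: the central [z] drops out of the commutator
   with [g], the factor [b] contributes an element of [K], and [[~ a, g]] already lies one step
   further down. *)
have step : L k.+1 \subset [~: L k.+1, G] * K.
  have nRG := normal_commg (nL k.+1).
  have RK : [~: L k.+1, G] * K = [~: L k.+1, G] <*> K.
    by rewrite norm_joinEr // (subset_trans (normal_sub nKG)) // nG.
  rewrite RK /= gen_subG; apply/subsetP=> _ /imset2P[l g lL gGg ->].
  have /mulsgP[_ z /mulsgP[a b aL bK ->] zZ ->] := subsetP LK l lL.
  have zC : z \in 'C(G) by case/setIP: (subsetP sZ z zZ).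
  rewrite commMgJ (_ : [~ z, g] = 1) ?mulg1; last first.
    by apply/eqP/commgP; exact: (centP zC).
  have abg : [~ a * b, g] \in G.
    rewrite groupR // groupM //; last exact: (subsetP (normal_sub nKG)).
    exact: (subsetP (normal_sub (nL k.+1))).
  rewrite (_ : _ ^ z = [~ a * b, g]); last first.
    by apply/conjg_fixP/commgP/commute_sym; exact: (centP zC).
  rewrite commMgJ groupM //; last first.
    apply: (subsetP (joing_subr _ _)); rewrite commgEl groupM ?groupV // memJ_norm //.
    exact: (subsetP (nG _ nKG)).
  apply: (subsetP (joing_subl _ _)).
  rewrite memJ_norm ?mem_commg //.
  exact: subsetP (nG _ nRG) _ (subsetP (normal_sub nKG) _ bK).
have : L k.+1 \subset K.
  have nLK : L k.+1 \subset 'N(K) := subset_trans (normal_sub (nL _)) (nG _ nKG).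
  (* Modulo [K] the group [L k.+1] lies in its own commutator with [G]; by the definition of
     [nilpotent] it is then trivial. *)
  have /forall_inP nilK : nilpotent (G / K) by exact/quotient_nil/(pgroup_nil pG).
  rewrite -quotient_sub1 //; suff /eqP-> : (L k.+1 / K)%G :==: 1 by [].
  apply: nilK; rewrite subsetI (quotientS _ (normal_sub (nL k.+1))).
  change (L k.+1 / K \subset [~: L k.+1 / K, G / K]).
  rewrite -quotientR ?nG // quotientSK // -(normC _) //.
  exact: subset_trans (normal_sub (normal_commg (nL k.+1))) (nG _ nKG).
by apply: subset_trans; exact: lower_series_sub.
Qed.
End FiniteGroups.

From mathcomp Require Import finmap zify ring lra.
From mathcomp Require Import all_classical all_reals all_analysis.
Import Order.TTheory GRing.Theory Num.Theory.

(** * Subgroups and finite quotients *)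

Section AbstractSubgroups.
Local Open Scope classical_set_scope.
Local Open Scope group_scope.
Variable G : topologicalGroupType.
Implicit Types (A B K S : set G).

Lemma subgroup1 K : is_subgroup K -> K 1.
Proof. by case. Qed.

Lemma subgroupV K a : is_subgroup K -> K a -> K a^-1.
Proof. by case=> K1 KV Ka; rewrite -[_^-1]mul1g; exact: KV. Qed.

Lemma subgroupM K a b : is_subgroup K -> K a -> K b -> K (a * b).
Proof.
by move=> sK Ka Kb; case: (sK) => _ KV; rewrite -[b]invgK; apply: KV => //; exact: subgroupV.
Qed.

Lemma is_subgroupM K : K 1 -> (forall a b, K a -> K b -> K (a * b)) ->
  (forall a, K a -> K a^-1) -> is_subgroup K.
Proof. by move=> K1 KM KV; split=> // a b Ka Kb; apply: KM => //; exact: KV. Qed.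

Lemma is_normalJ K a b : is_normal K -> K a -> K (a ^ b).
Proof. by case=> _; apply. Qed.

Lemma is_subgroupI A B : is_subgroup A -> is_subgroup B -> is_subgroup (A `&` B).
Proof.
by case=> A1 AV [B1 BV]; split=> // a b [Aa Ba] [Ab Bb]; split; [exact: AV|exact: BV].
Qed.

Lemma is_normalI A B : is_normal A -> is_normal B -> is_normal (A `&` B).
Proof.
case=> sA nA [sB nB]; split; first exact: is_subgroupI.
by move=> a b [Aa Ba]; split; [exact: nA|exact: nB].
Qed.

Lemma closed_gen_sub A K : is_subgroup K -> closed K -> A `<=` K -> closed_gen A `<=` K.
Proof. by move=> sK cK sAK g; apply. Qed.

Lemma closed_gen_incl A : A `<=` closed_gen A.
Proof. by move=> a Aa K [_ _]; apply. Qed.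

Lemma cosetE S a b : is_subgroup S ->
  (setmul [set a] S = setmul [set b] S) <-> S (a^-1 * b).
Proof.
move=> sS; split=> [e|Sab].
  have [_ -> [s Ss <-]] : setmul [set a] S b.
    by rewrite e; exists b => //; exists 1; [exact: subgroup1|rewrite mulg1].
  by rewrite mulKg.
apply/seteqP; split=> _ [_ -> [s Ss <-]].
  exists b => //; exists (b^-1 * a * s); last by rewrite -mulgA mulKVg.
  by apply: subgroupM => //; rewrite -[_ * a]invgK invgM invgK; exact: subgroupV.
exists a => //; exists (a^-1 * b * s); last by rewrite -mulgA mulKVg.
exact: subgroupM.
Qed.

Definition fimage (T : finType) (f : G -> T) A : {set T} :=
  finset (fun z => `[< exists2 a, A a & f a = z >]).

Lemma fimageP (T : finType) (f : G -> T) A z :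
  reflect (exists2 a, A a & f a = z) (z \in fimage f A).
Proof. by rewrite inE; exact: asboolP. Qed.

Lemma mem_fimage (T : finType) (f : G -> T) A a : A a -> f a \in fimage f A.
Proof. by move=> Aa; apply/fimageP; exists a. Qed.

Lemma fimageS (T : finType) (f : G -> T) A B : A `<=` B -> fimage f A \subset fimage f B.
Proof. by move=> sAB; apply/fintype.subsetP=> _ /fimageP[a Aa <-]; exact/mem_fimage/sAB. Qed.

(** The fibres of [f] are the left cosets of [S], so counting cosets becomes counting values. All
    later indices are computed in this way in finite quotients, also for sets [A] that are not
    subgroups. *)
Lemma card_fimage_index (T : finType) (f : G -> T) A S : is_subgroup S ->
  (forall a b, f a = f b <-> S (a^-1 * b)) -> Defs.index A S = #|fimage f A|.
Proof.
move=> sS fE; rewrite /Defs.index.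
have e a b : f a = f b <-> setmul [set a] S = setmul [set b] S.
  by rewrite fE cosetE.
pose h (z : T) : set G := setmul [set a | f a = z] S.
have hE a : h (f a) = setmul [set a] S.
  apply/seteqP; split=> [_ [b fb [s Ss <-]]|_ [_ -> [s Ss <-]]]; last first.
    by exists a => //; exists s.
  move: fb => /= /esym/e->; exists b => //; exists s => //.
have -> : [set setmul [set a] S | a in A] =
    [set` [fset h z | z in fimage f A]%fset].
  apply/seteqP; split=> [_ [a Aa <-]|X].
    by rewrite -hE /=; apply/imfsetP; exists (f a) => //=; exact: mem_fimage.
  move=> /imfsetP[z /= /fimageP[a Aa <-] ->]; exists a => //.
rewrite set_fsetK card_in_imfset /=; first by rewrite -cardE.
move=> _ _ /fimageP[a Aa <-] /fimageP[b Ab <-]; rewrite !hE => /e; exact.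
Qed.

Lemma index_setmul K S : is_subgroup S -> Defs.index (setmul K S) S = Defs.index K S.
Proof.
move=> sS; rewrite /Defs.index; congr (#|` fset_set _|).
apply/seteqP; split=> [_ [_ [k Kk [s Ss <-]] <-]|_ [k Kk <-]].
  exists k => //; apply/cosetE => //; rewrite mulgA mulVg mul1g //.
by exists k => //; exists k => //; exists 1; rewrite ?mulg1 //; exact: subgroup1.
Qed.

(* [G / S] acts faithfully on the cosets by permutations. *)
Lemma finite_quotient S : is_normal S -> (0 < Defs.index setT S)%N ->
  exists (gT : finGroupType) (rho : G -> gT),
    [/\ {morph rho : a b / a * b}, forall a, rho a = 1 <-> S a &
        forall z, exists a, rho a = z].
Proof.
move=> nS; have sS := nS.1.
rewrite /Defs.index; set X := [set _ | _ in _] => X0.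
(* An infinite set has the empty [fset_set], so a positive index forces finitely many cosets. *)
have finX : finite_set X.
  by apply: contrapT => infX; move: X0; rewrite /fset_set; case: pselect => //; rewrite cardfs0.
pose T : finType := fset_set X.
have memT a : setmul [set a] S \in fset_set X.
  by rewrite in_fset_set // inE; exists a.
pose c a : T := [` memT a]%fset.
have cE a b : c a = c b <-> S (a^-1 * b).
  rewrite -cosetE //; split=> [/(congr1 val)//|h]; exact: val_inj.
have cS (t : T) : exists a, c a = t.
  have := fsvalP t; rewrite in_fset_set // inE => -[a _ ea].
  by exists a; apply: val_inj.
pose r t := projT1 (cid (cS t)).
have rK t : c (r t) = t by rewrite /r; case: cid.
(* The inverse turns left multiplication into a right action, as the product of permutations
   requires. *)
pose act a t := c (a^-1 * r t).
have actE a b : act a (c b) = c (a^-1 * b).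
  apply/cE; rewrite invgM invgK -mulgA mulKVg.
  exact/cE.
have actM a b t : act (a * b) t = act b (act a t).
  by rewrite -[t]rK !actE invgM mulgA.
have act1 t : act 1 t = t by rewrite -[t]rK actE invg1 mul1g.
have actI a : injective (act a).
  by apply: (can_inj (g := act a^-1)) => t; rewrite -actM mulgV act1.
pose rho0 a : {perm T} := perm (@actI a).
have rho0M : {morph rho0 : a b / a * b}.
  by move=> a b; apply/permP=> t; rewrite permM !permE actM.
have rho01 : rho0 1 = 1 by apply: (mulgI (rho0 1)); rewrite -rho0M !mulg1.
have grp : group_set (fimage rho0 setT).
  apply/group_setP; split; first by apply/fimageP; exists 1.
  by move=> _ _ /fimageP[a _ <-] /fimageP[b _ <-]; rewrite -rho0M mem_fimage.
pose Q := Group grp; exists (subg_of Q), (fun a => subg Q (rho0 a)).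
have mQ a : rho0 a \in Q by exact: mem_fimage.
split=> [a b|a|z].
- by rewrite rho0M -morphM.
- split=> [/(congr1 val)|Sa].
    rewrite /= subgK // => /permP/(_ (c 1)).
    rewrite permE perm1 actE mulg1 => /cE; rewrite invgK mulg1 //.
  rewrite (_ : rho0 a = 1) ?morph1 //; apply/permP=> t; rewrite permE perm1.
  rewrite -[t]rK actE; apply/cE; rewrite invgM invgK -mulgA.
  exact: (is_normalJ (r t) nS Sa).
- case/fimageP: (subgP z) => a _ ea; exists a.
  by apply: val_inj; rewrite /= ea subgK ?subgP.
Qed.
End AbstractSubgroups.

(** * Finite groups with the discrete topology *)

Definition discrete_group (gT : finGroupType) : Type := gT.

Section DiscreteGroup.
Variable gT : finGroupType.
HB.instance Definition _ := Choice.copy (discrete_group gT) gT.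
HB.instance Definition _ := Topological.copy (discrete_group gT) (discrete_topology gT).
HB.instance Definition _ := Group.copy (discrete_group gT) gT.
Local Open Scope group_scope.

Lemma nbhs_discrete_group (u : discrete_group gT) (A : set (discrete_group gT)) :
  A u -> nbhs u A.
Proof.
move=> Au; have nu : nbhs u [set u]%classic.
  exact: (discrete_set1 (u : discrete_topology gT)).
have su : ([set u] `<=` A)%classic by move=> _ ->.
exact (@filterS _ (nbhs u) _ _ _ su nu).
Qed.

Let mul_continuous :
  continuous (fun z : discrete_group gT * discrete_group gT => z.1 * z.2).
Proof.
move=> z U /nbhs_singleton Uz.
exists ([set z.1]%classic, [set z.2]%classic); first by split; exact: nbhs_discrete_group.
by case=> z1 z2 /= [-> ->].
Qed.

Let inv_continuous : continuous (fun z : discrete_group gT => z^-1).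
Proof.
move=> z U /nbhs_singleton Uz.
exact: nbhs_discrete_group.
Qed.

HB.instance Definition _ :=
  isTopologicalGroup.Build (discrete_group gT) mul_continuous inv_continuous.
End DiscreteGroup.

Section Topology.
Local Open Scope classical_set_scope.
Local Open Scope group_scope.

Lemma continuous_mulgl (G : topologicalGroupType) (a : G) : continuous (fun z : G => a * z).
Proof.
move=> z; apply: (@continuous_comp _ _ _ (fun w : G => (a, w)) (fun w : G * G => w.1 * w.2)).
  by apply: cvg_pair; [exact: cvg_cst|exact: cvg_id].
exact: mulg_continuous.
Qed.

Lemma open_coset_union (G : topologicalGroupType) (U A : set G) : open U -> is_subgroup U ->
  (forall a u, A a -> U u -> A (a * u)) -> open A.
Proof.
move=> oU sU AU; rewrite openE => a Aa; rewrite /interior.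
have : nbhs a ((fun z => a^-1 * z) @^-1` U).
  apply: open_nbhs_nbhs; split; first by apply: open_comp => // z _; exact: continuous_mulgl.
  by rewrite /= mulVg; exact: subgroup1.
by apply: filterS => z /= Uz; rewrite -[z](mulKVg a); exact: AU.
Qed.

Lemma open_subgroup_closed (G : topologicalGroupType) (U : set G) :
  open U -> is_subgroup U -> closed U.
Proof.
move=> oU sU; rewrite -openC; apply: (open_coset_union oU sU) => a u nUa Uu Uau.
by apply: nUa; rewrite -[a](mulgK u); exact: sU.2.
Qed.

Lemma continuous_coset (G : topologicalGroupType) (X : topologicalType) (U : set G)
    (f : G -> X) : open U -> is_subgroup U ->
  (forall a u, U u -> f (a * u) = f a) -> continuous f.
Proof.
move=> oU sU fU; apply/continuousP => A _.
by apply: (open_coset_union oU sU) => a u /= Aa Uu; rewrite fU.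
Qed.

(** These groups are the targets to which the universal property of the free pro-p group is
    applied. *)
Lemma pro_p_discrete_group (p : nat) (gT : finGroupType) :
  prime p -> p.-group [set: gT]%SET -> pro_p p (discrete_group gT).
Proof.
move=> pp pG.
have op (A : set (discrete_group gT)) : open A.
  by rewrite openE => a Aa; exact: nbhs_discrete_group.
split.
- exact/finite_compact/finite_finset.
- move=> a b /(_ [set a] [set b]) ab.
  by have [||_ [-> ->]] := ab _ _; [exact: nbhs_discrete_group..|].
- move=> U U1; exists [set 1]; last by move=> _ ->; exact: nbhs_singleton.
  by split=> //; split=> // a b -> ->; rewrite mulgV.
- move=> K oK [sK _].
  have grp : group_set (fimage (id : discrete_group gT -> gT) K).
    apply/group_setP; split; first by apply/fimageP; exists 1 => //; exact: subgroup1.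
    move=> _ _ /fimageP[a Ka <-] /fimageP[b Kb <-]; apply/fimageP; exists (a * b) => //.
    exact: subgroupM.
  pose f (a : discrete_group gT) : {set gT} := lcoset (Group grp) a.
  rewrite -index_setmul // index_setmul // (card_fimage_index (f := f)) //; last first.
    move=> a b; rewrite /f !lcosetE; split=> [e|Kab].
      have : b \in a *: Group grp by rewrite e lcoset_refl.
      rewrite mem_lcoset => /fimageP[c Kc /= <-]; exact: Kc.
    apply/lcoset_eqP; rewrite mem_lcoset; apply/fimageP; exists (b^-1 * a) => //.
    by rewrite -[b^-1 * a]invgK invgM invgK; exact: subgroupV.
  have -> : fimage f setT = lcosets (Group grp) [set: gT]%SET.
    apply/setP=> X; apply/fimageP/imsetP=> [[a _ <-]|[a _ ->]]; by exists a.
  rewrite card_lcosets.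
  have := pnat_dvd (dvdn_indexg _ (Group grp)) pG.
  by case/p_natP => k ->; exists k.
Qed.
End Topology.

(** * Pro-p groups *)

Section ProP.
Local Open Scope classical_set_scope.
Local Open Scope group_scope.

Lemma morphg1 (G H : groupType) (f : G -> H) : {morph f : a b / a * b} -> f 1 = 1.
Proof. by move=> fM; apply: (mulgI (f 1)); rewrite -fM !mulg1. Qed.

Lemma morphgV (G H : groupType) (f : G -> H) : {morph f : a b / a * b} ->
  {morph f : a / a^-1}.
Proof. by move=> fM a; apply: (mulgI (f a)); rewrite -fM !mulgV morphg1. Qed.

Lemma morphgX (G H : groupType) (f : G -> H) n : {morph f : a b / a * b} ->
  {morph f : a / a ^+ n}.
Proof.
by move=> fM a; elim: n => [|n ih]; rewrite ?expg0 ?morphg1 // !expgS fM ih.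
Qed.

Lemma morphgR (G H : groupType) (f : G -> H) : {morph f : a b / a * b} ->
  {morph f : a b / [~ a, b]}.
Proof. by move=> fM a b; rewrite /commg /conjg !fM !morphgV. Qed.

Lemma morphgJ (G H : groupType) (f : G -> H) : {morph f : a b / a * b} ->
  {morph f : a b / a ^ b}.
Proof. by move=> fM a b; rewrite /conjg !fM !morphgV. Qed.

Lemma morphg_eq (G : topologicalGroupType) (H : groupType) (f : G -> H) (U : set G) :
  {morph f : a b / a * b} -> (forall a, f a = 1 <-> U a) ->
  forall a b, f a = f b <-> U (a^-1 * b).
Proof.
move=> fM fU a b; rewrite -fU fM morphgV //; split=> [->|e]; first by rewrite mulVg.
by rewrite -[f b](mulKVg (f a)) e mulg1.
Qed.

Lemma preimage_subgroup (G H : topologicalGroupType) (f : G -> H) (K : set H) :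
  {morph f : a b / a * b} -> is_subgroup K -> is_subgroup (f @^-1` K).
Proof.
move=> fM [K1 KV]; split=> [|a b]; rewrite /= ?morphg1 // fM morphgV //; exact: KV.
Qed.

Lemma preimage_normal (G H : topologicalGroupType) (f : G -> H) (K : set H) :
  {morph f : a b / a * b} -> is_normal K -> is_normal (f @^-1` K).
Proof.
move=> fM [sK nK]; split; first exact: preimage_subgroup.
by move=> a b /= Ka; rewrite morphgJ //; exact: nK.
Qed.

Lemma fimage_group (G : topologicalGroupType) (gT : finGroupType) (f : G -> gT) (K : set G) :
  {morph f : a b / a * b} -> is_subgroup K -> group_set (fimage f K).
Proof.
move=> fM sK; apply/group_setP; split.
  by apply/fimageP; exists 1; [exact: subgroup1|exact: morphg1].
move=> _ _ /fimageP[a Ka <-] /fimageP[b Kb <-]; rewrite -fM mem_fimage //.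
exact: subgroupM.
Qed.

Record finite_quotient_map (p : nat) (G : topologicalGroupType) (gT : finGroupType)
    (rho : G -> gT) (U : set G) : Prop := FiniteQuotientMap {
  fqm_morph : {morph rho : a b / a * b};
  fqm_ker : forall a, rho a = 1 <-> U a;
  fqm_onto : forall z, exists a, rho a = z;
  fqm_pgroup : p.-group [set: gT]%SET }.

Lemma pro_p_quotient (p : nat) (F : topologicalGroupType) (U : set F) :
  prime p -> pro_p p F -> open U -> is_normal U ->
  exists (gT : finGroupType) (rho : F -> gT), finite_quotient_map p rho U.
Proof.
move=> pp [_ _ _ /(_ U)] iU oU nU; have {iU} [k iU] := iU oU nU.
have [|gT [rho [rM rU rS]]] := finite_quotient nU; first by rewrite iU expn_gt0 prime_gt0.
exists gT, rho; split=> //; rewrite /pgroup.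
rewrite (_ : [set: gT]%SET = fimage rho setT); last first.
  by apply/setP=> z; rewrite inE; have [a <-] := rS z; rewrite mem_fimage.
rewrite -(card_fimage_index _ nU.1); first by rewrite iU pnatX pnat_id.
exact: morphg_eq.
Qed.

(** If the image of [T] in the finite quotient were proper, it would lie in a maximal subgroup [M'],
    which is normal in a [p]-group. The projection of [F] modulo [M'] and the trivial map both send
    [x] and [y] to 1, so uniqueness identifies them, which contradicts that [M'] is proper. *)
Lemma free_pro_p2_gen (p : nat) (F : topologicalGroupType) (x y : F) (T U : set F) :
  prime p -> free_pro_p2 p x y -> open U -> is_normal U -> U `<=` T ->
  is_subgroup T -> T x -> T y -> T = setT.
Proof.
move=> pp [pF univ] oU nU sUT sT Tx Ty.
have [gT [rho [rM rU rS pG]]] := pro_p_quotient pp pF oU nU.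
pose M := Group (fimage_group rM sT).
have [MT|MnT] := eqVneq M [set: gT]%G.
  apply/seteqP; split=> // a _.
  have : rho a \in M by rewrite MT inE.
  case/fimageP=> t Tt /(morphg_eq rM rU) Ut.
  by rewrite -[a](mulKVg t); apply: subgroupM => //; exact: sUT.
have prM : M \proper [set: gT]%G by rewrite finset.properEneq MnT finset.subsetT.
have [M' maxM sMM'] := @maxgroup_exists _ (fun N : {group gT} => N \proper [set: gT]%SET) M prM.
have nM' := p_maximal_normal pG maxM.
have nM a : rho a \in 'N(M').
  by case/andP: nM' => _ /fintype.subsetP; apply; rewrite inE.
pose Q := discrete_group (coset_of M').
have pQ : pro_p p Q.
  apply: pro_p_discrete_group => //.
  rewrite (_ : [set: _]%SET = [set: gT]%SET / M'); first exact: quotient_pgroup.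
  apply/setP=> z; rewrite inE; case: (cosetP z) => u nu ->.
  by rewrite mem_quotient ?inE.
pose f (a : F) : Q := coset M' (rho a).
have fM : {morph f : a b / a * b} by move=> a b; rewrite /f rM morphM ?nM.
have [g [_ uniq]] := univ Q 1 1 pQ.
have f1 a : T a -> f a = 1.
  by move=> Ta; apply: coset_id; apply: (fintype.subsetP sMM'); exact: mem_fimage.
have gf : g = f.
  apply: uniq; split; rewrite ?f1 //; split=> //.
  apply: (continuous_coset oU nU.1) => a u Uu.
  by rewrite fM (f1 u (sUT u Uu)) mulg1.
have g1 : g = fun=> 1.
  apply: uniq; split=> //; split; first by move=> a; exact: cvg_cst.
  by move=> a b; rewrite mulg1.
have : M' :=: [set: gT]%SET.
  apply/setP=> z; rewrite inE; have [a <-] := rS z.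
  apply: coset_idr; first exact: nM.
  by have : f a = 1 by rewrite -gf g1.
by case/maxgroupP: maxM => /proper_neq/eqP.
Qed.
End ProP.

(** * The group G as a central cover of the wreath product *)

(* The properties of [G], [Z] and the images [x], [y] of the free generators
   that the rest uses: [tau k g] is the exponent of [x] in [g] modulo
   [p ^ k.+1], and [V k] the kernel of [G -> C_p wr C_(p ^ k.+1)]. *)
Record central_wreath_cover (p : nat) (G : topologicalGroupType) (x y : G)
    (Z : set G) (tau : forall k, G -> 'Z_(p ^ k.+1)) (V : nat -> set G) : Prop := {
  cwc_compact : compact [set: G];
  cwc_quotient : forall U : set G, open U -> is_normal U ->
    exists (gT : finGroupType) (rho : G -> gT), finite_quotient_map p rho U;
  cwc_gen : forall T U : set G, open U -> is_normal U -> (U `<=` T)%classic ->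
    is_subgroup T -> T x -> T y -> T = setT;
  cwc_subgroup : is_subgroup Z;
  cwc_central : forall z g, Z z -> (z * g = g * z)%g;
  cwc_exponent : forall z, Z z -> (z ^+ p = 1)%g;
  cwc_tau_open : forall k, open (tau k @^-1` [set 0%R])%classic;
  cwc_tauM : forall k, {morph tau k : a b / (a * b)%g >-> (a + b)%R};
  cwc_tau_x : forall k, tau k x = 1%R;
  cwc_tau_y : forall k, tau k y = 0%R;
  cwc_abelian : forall a b, (forall k, tau k a = 0%R) -> (forall k, tau k b = 0%R) ->
    Z [~ a, b]%g;
  cwc_yX : Z (y ^+ p)%g;
  cwc_open : forall k, open (V k) /\ is_normal (V k);
  cwc_ker : forall g, Z g <-> forall k, V k g;
  cwc_center : forall g, ~ Z g -> ~ (Z [~ g, x]%g /\ Z [~ g, y]%g);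
  cwc_Vx : forall k n, V k (x ^+ n)%g -> p ^ k.+1 %| n
}.

(** * Finite wreath products and their centres *)

Section Wreath.
Local Open Scope ring_scope.

Lemma wreathM1 (a b : nat) (u v : wreath a b) : (u * v)%g.1 = u.1 + v.1.
Proof. by []. Qed.

Lemma wreathM2 (a b : nat) (u v : wreath a b) (j : 'Z_b) :
  (u * v)%g.2 j = u.2 (j - v.1) + v.2 j.
Proof. by rewrite /= ffunE. Qed.

Lemma wreath_base_comm (a b : nat) (u v : wreath a b) : u.1 = 0 -> v.1 = 0 ->
  (u * v = v * u)%g.
Proof.
move=> u0 v0; apply/eqP; rewrite /eq_op /=; apply/andP; split.
  by rewrite u0 v0.
by apply/eqP/ffunP=> j; rewrite !ffunE u0 v0 !subr0 addrC.
Qed.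

Lemma wreath_topX (a b n : nat) : (wreath_top a b ^+ n)%g.1 = n%:R.
Proof. by elim: n => [|n ih] //; rewrite expgS wreathM1 ih /= -natr1 addrC. Qed.

Lemma wreath_baseX (a b n : nat) (u : wreath a b) : u.1 = 0 ->
  (u ^+ n)%g.1 = 0 /\ forall j, (u ^+ n)%g.2 j = u.2 j *+ n.
Proof.
move=> u0; elim: n => [|n [ih1 ih2]]; first by split=> // j; rewrite ffunE.
split; first by rewrite expgS wreathM1 u0 ih1 addr0.
by move=> j; rewrite expgS wreathM2 ih1 subr0 ih2 mulrS.
Qed.

Lemma wreath_eq1 (a b : nat) (u : wreath a b) : u.1 = 0 -> (forall j, u.2 j = 0) -> u = 1%g.
Proof.
case: u => c f /= -> f0; congr pair.
by apply/ffunP => j; rewrite f0 ffunE.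
Qed.

Lemma natr_Zp0 (n N : nat) : (1 < N)%N -> (n%:R == 0 :> 'Z_N) = (N %| n)%N.
Proof.
by move=> N1; rewrite -Zp_nat_mod // -val_eqE /= val_Zp_nat ?modn_mod.
Qed.

(** Commuting with the base generator, read at coordinate 0, forces the top component to vanish;
    commuting with the top generator makes the base component invariant under shifts. The constant
    functions that remain are central and cannot be excluded at a finite level. *)
Lemma wreath_center (a b : nat) (u : wreath a b) :
  (u * wreath_top a b = wreath_top a b * u)%g ->
  (u * wreath_base a b = wreath_base a b * u)%g ->
  u.1 = 0 /\ forall j, u.2 j = u.2 0.
Proof.
move=> ux uy; split.
  have := congr1 (fun w : wreath a b => w.2 0) uy.
  rewrite !wreathM2 /= !ffunE subr0 eqxx addrC sub0r oppr_eq0 => /addIr.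
  by case: (u.1 =P 0) => // _ /eqP; rewrite oner_eq0.
have step j : u.2 j = u.2 (j - 1).
  have := congr1 (fun w : wreath a b => w.2 j) ux.
  by rewrite !wreathM2 /= !ffunE addr0 add0r.
move=> j; rewrite -[j]natr_Zp; elim: (j : nat) => [|n ih] //.
by rewrite step -natr1 addrK.
Qed.

Lemma count_modn (M n j : nat) : (j < M)%N ->
  (\sum_(0 <= i < n * M | i %% M == j) 1 = n)%N.
Proof.
move=> jM; elim: n => [|n ih]; first by rewrite mul0n big_geq.
rewrite mulSn (big_cat_nat (n := n * M)) ?leq_addl //= ih -[RHS]addn1; congr addn.
rewrite -{1}[(n * M)%N]add0n big_addn addnK.
under eq_bigl do rewrite addnC modnMDl.
rewrite big_mkcond (bigD1_seq j) ?mem_index_iota ?iota_uniq //=.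
rewrite modn_small // eqxx big1_seq ?addn0 // => i /andP[ij].
by rewrite mem_index_iota => /andP[_ iM]; rewrite modn_small // (negPf ij).
Qed.

(** Each fibre of the reduction has [p] elements, so a constant [v] is sent to [p] times [v], which
    is 0. Central elements of one level thus die one level below, and the inverse limit has trivial
    centre. *)
Lemma wreath_red_const (p k : nat) (u : wreath p (p ^ k.+2)) (v : 'Z_p) :
  prime p -> (forall j, u.2 j = v) -> forall j, (wreath_red (p ^ k.+1) u).2 j = 0.
Proof.
move=> pp uv j; have p1 := prime_gt1 pp.
have M1 n : (1 < p ^ n.+1)%N by rewrite -(exp1n n.+1) ltn_exp2r.
rewrite ffunE (eq_bigr _ (fun i _ => uv i)) sumr_const.
suff -> : #|[pred i : 'Z_(p ^ k.+2) | (i : nat)%:R == j]| = p.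
  by rewrite -mulr_natr pchar_Zp ?mulr0.
have jM : (j < p ^ k.+1)%N by rewrite -[X in (_ < X)%N](Zp_cast (M1 k)).
have NE : (p * p ^ k.+1 = (Zp_trunc (p ^ k.+2)).+2)%N by rewrite Zp_cast // -expnS.
rewrite -[RHS](count_modn p jM) -sum1_card NE big_mkord.
apply: eq_bigl => i; rewrite inE -val_eqE /= val_Zp_nat //.
Qed.
End Wreath.

Section Cover.
Local Open Scope classical_set_scope.
Local Open Scope group_scope.

Lemma open_wreath (a b : nat) (A : set (wreath a b)) : open A.
Proof.
rewrite openE => u Au; have su : [set u] `<=` A by move=> _ ->.
exact (@filterS _ (nbhs u) _ _ _ su (@wreath_nbhs1 a b u)).
Qed.

Lemma open_gprod_wreath (p k : nat) (X : topologicalType) (f : X -> gprod (wreath_tower p))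
    (A : set (wreath_tower p k)) : continuous f -> open [set a | A (f a k)].
Proof.
move=> cf; apply: (@open_comp _ _ (fun a => f a k)); last exact: open_wreath.
move=> a _; apply: (@continuous_comp _ _ _ f (fun w : gprod (wreath_tower p) => w k)).
  exact: cf.
exact: gprod_proj_continuous.
Qed.

Lemma closed_gprod_wreath (p k : nat) (X : topologicalType) (f : X -> gprod (wreath_tower p))
    (A : set (wreath_tower p k)) : continuous f -> closed [set a | A (f a k)].
Proof. by move=> cf; rewrite -openC; exact: (open_gprod_wreath (~` A)). Qed.

Lemma WB_top0 (p : nat) (w : gprod (wreath_tower p)) (k : nat) : WB p w -> (w k).1 = 0%R.
Proof.
pose K := \bigcap_k [set w : gprod (wreath_tower p) | (w k).1 = 0%R].
suff sWK : WB p `<=` K by move/sWK; exact.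
apply: closed_gen_sub.
- split=> // a b Ka Kb i _ /=.
  change ((a i).1 - (b i).1 = 0)%R; rewrite (Ka i I) (Kb i I) subr0 //.
- apply: closed_bigI => i _.
  exact: (@closed_gprod_wreath p i _ idfun [set u | u.1 = 0%R] (fun=> cvg_id)).
- have yJ a i : ((Wy p ^ a) i).1 = 0%R.
    by change (- (a i).1 + (0 + (a i).1) = 0)%R; rewrite add0r addNr.
  by move=> _ [] [i _ <-] j _; exact: yJ.
Qed.

Lemma central_wreath_coverP (p : nat) (F G : topologicalGroupType) (x y : F)
    (phi : F -> gprod (wreath_tower p)) (q : F -> G) :
  prime p -> free_pro_p2 p x y -> continuous_hom phi -> phi @` setT = W p ->
  phi x = Wx p -> phi y = Wy p -> is_quotient (Nsub phi) q ->
  exists tau V, central_wreath_cover (q x) (q y) (Zsub phi q) tau V /\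
    forall g k, Hsub phi q g -> tau k g = 0%R :> 'Z_(p ^ k.+1).
Proof.
move=> pp fF [cphi phiM] phiW phix phiy [qM qS qN qO].
have p1 := prime_gt1 pp.
have sker : is_subgroup (Defs.ker phi).
  split; first exact: morphg1.
  by move=> a b; rewrite /Defs.ker /= phiM morphgV // => -> ->; rewrite mulgV.
(* The kernel is closed, since equality with 1 is tested in the discrete levels, and it contains the
   generators of [N]. *)
have NR : Nsub phi `<=` Defs.ker phi.
  apply: closed_gen_sub => //.
    rewrite (_ : Defs.ker phi = \bigcap_k [set a | phi a k = 1]).
      apply: (@closed_bigI _ _ setT (fun k => [set a | phi a k = 1])) => k _.
      exact: (@closed_gprod_wreath p k _ phi [set 1]).
    apply/seteqP; split=> [a ha k _|a h]; first by rewrite /= (ha : phi a = 1).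
    apply/functional_extensionality_dep => k.
    exact: (h k I).
  move=> _ [[r rR [f _ <-]]|[r rR <-]]; rewrite /Defs.ker /=.
    by rewrite morphgR // (rR : phi r = 1) comm1g.
  by rewrite morphgX // (rR : phi r = 1) expg1n.
have qker a : q a = 1 <-> Nsub phi a by rewrite -qN.
have qC : continuous q by apply/continuousP => A /qO.
have qsurj g : exists a, q a = g.
  have [a _ <-] : (q @` setT) g by rewrite qS.
  by exists a.
(* The map from [G] to [W] induced by [phi], through a chosen preimage under [q]; [pgE] shows that
   the choice does not matter. *)
pose pg g := phi (projT1 (cid (qsurj g))).
have pgE a : pg (q a) = phi a.
  rewrite /pg; case: cid => b /= /(morphg_eq qM qker)/NR h.
  by apply/(morphg_eq (U := Defs.ker phi) phiM).
have pgM : {morph pg : a b / a * b}.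
  by move=> a b; have [c <-] := qsurj a; have [d <-] := qsurj b; rewrite -qM !pgE.
have pgkM k : {morph (fun g => pg g k) : a b / a * b} by move=> a b; rewrite pgM.
have pgO k (A : set (wreath_tower p k)) : open [set g | A (pg g k)].
  apply/qO; rewrite (_ : q @^-1` _ = [set a | A (phi a k)]).
    exact: (@open_gprod_wreath p k _ phi A cphi).
  by apply/seteqP; split=> a /=; rewrite pgE.
have red g k : wreath_red (p ^ k.+1) (pg g k.+1) = pg g k.
  by have [a <-] := qsurj g; rewrite pgE; have : W p (phi a) by rewrite -phiW; exists a.
pose V k := [set g | pg g k = 1].
have nV k : is_normal (V k).
  split; first split; first exact: (morphg1 (pgkM k)).
    by move=> a b; rewrite /V /= (pgkM k) (morphgV (pgkM k)) => -> ->; rewrite mulgV.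
  by move=> a b; rewrite /V /= (morphgJ (pgkM k)) => ->; rewrite conj1g.
have ZV g : Zsub phi q g <-> forall k, V k g.
  split=> [[a ka <-] k|h]; first by rewrite /V /= pgE (ka : phi a = 1).
  have [a ag] := qsurj g; exists a => //; apply/functional_extensionality_dep => k.
  by rewrite -pgE ag; exact: h.
have qNr a : Nsub phi a -> q a = 1 by move/qker.
exists (fun k g => (pg g k).1), V; split; last first.
  by move=> _ k [a + <-]; rewrite pgE; exact: WB_top0.
split=> //.
- rewrite -qS; apply: continuous_compact; last by case: fF => [[]].
  exact: continuous_subspaceT.
- move=> U oU nU; have [gT [rho [rM rU rS rp]]] := pro_p_quotient pp fF.1
    (proj1 (qO U) oU) (preimage_normal qM nU).
  have rq a b : q a = q b -> rho a = rho b.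
    move=> e; apply/(morphg_eq rM rU); rewrite /= qM morphgV // e mulVg.
    exact: subgroup1 nU.1.
  pose r g := rho (projT1 (cid (qsurj g))).
  have rE a : r (q a) = rho a by rewrite /r; case: cid => b /= /rq.
  exists gT, r; split=> // [a b|g|z].
  + have [c <-] := qsurj a; have [d <-] := qsurj b; by rewrite -qM !rE rM.
  + by have [c <-] := qsurj g; rewrite rE rU.
  + by have [a <-] := rS z; exists (q a).
- move=> T U oU nU sUT sT Tx Ty.
  have /seteqP[_ TT] := free_pro_p2_gen pp fF (proj1 (qO U) oU) (preimage_normal qM nU)
    (fun a => sUT (q a)) (preimage_subgroup qM sT) Tx Ty.
  by apply/seteqP; split=> // g _; have [a <-] := qsurj g; exact: TT.
- split; first by apply/ZV => k; exact: subgroup1 (nV k).1.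
  by move=> a b /ZV Za /ZV Zb; apply/ZV => k; case: (nV k) => -[_ h] _; exact: h.
- move=> z g [r rR <-]; have [f <-] := qsurj g.
  apply/commgP/eqP; rewrite -morphgR // qNr //; apply: closed_gen_incl; left.
  by exists r => //; exists f.
- move=> z [r rR <-]; rewrite -morphgX // qNr //; apply: closed_gen_incl; right.
  by exists r.
- by move=> k; exact: (pgO k [set u | u.1 = 0%R]).
- by move=> k a b; rewrite pgM.
- by move=> k; rewrite pgE phix.
- by move=> k; rewrite pgE phiy.
- move=> a b a0 b0; apply/ZV => k; rewrite /V /= (morphgR (pgkM k)).
  by apply/eqP/commgP; exact: wreath_base_comm.
- apply/ZV => k; rewrite /V /= (morphgX _ (pgkM k)) pgE phiy.
  have [h1 h2] := @wreath_baseX p (p ^ k.+1) p (Wy p k) erefl.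
  apply: wreath_eq1 => // j; rewrite h2 -mulr_natr pchar_Zp ?mulr0 //.
- by move=> k; split; [exact: (pgO k [set 1])|exact: nV].
(* At every level the image of [g] commutes with both generators, hence is a constant function;
   level [k] is the reduction of level [k.+1], where constants vanish. *)
- move=> g nZ [/ZV gx /ZV gy]; apply: nZ; apply/ZV => k.
  have c j : (pg g j).1 = 0%R /\ forall i, (pg g j).2 i = (pg g j).2 0%R.
    apply: wreath_center.
      have := gx j; rewrite /V /= (morphgR (pgkM j)) pgE phix => /eqP/commgP //.
    have := gy j; rewrite /V /= (morphgR (pgkM j)) pgE phiy => /eqP/commgP //.
  apply: wreath_eq1; first exact: (c k).1.
  by move=> j; rewrite -red; exact: wreath_red_const pp (c k.+1).2 j.
- move=> k n; rewrite /V /= (morphgX _ (pgkM k)) pgE phix.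
  move=> /(congr1 fst); rewrite wreath_topX /= => /eqP.
  by rewrite natr_Zp0 // -(exp1n k.+1) ltn_exp2r.
Qed.
End Cover.

(** * Normal subgroups that are not contained in Z *)

Section Filtration.
Local Open Scope classical_set_scope.
Local Open Scope group_scope.

(** A cluster point of a sequence with [c i] in [C i] lies in every [C i], as this closed set
    contains a tail of the sequence. *)
Lemma compact_decreasing (T : topologicalType) (C : nat -> set T) :
  compact [set: T] -> (forall i, closed (C i)) -> (forall i, C i.+1 `<=` C i) ->
  (forall i, C i !=set0) -> exists z, forall i, C i z.
Proof.
move=> cT cC dC nC.
have dC' i j : (i <= j)%N -> C j `<=` C i.
  move=> /subnK <-; elim: (j - i)%N => // d ih; exact: subset_trans (dC _) ih.
have [c cE] := choice nC.
have [z [_ zc]] := cT (c @ \oo) _ (filterT).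
exists z => i; apply: cC => B nB.
have [|w [Cw Bw]] := zc (C i) B _ nB; last by exists w.
by exists i => // j ij; exact: dC' ij _ (cE j).
Qed.

Lemma filtration_decreasing (G : topologicalGroupType) (S : nat -> set G) i j :
  filtration_series S -> (i <= j)%N -> S j `<=` S i.
Proof.
move=> [_ dS _ _] /subnK <-; elim: (j - i)%N => // d ih; exact: subset_trans (dS _) ih.
Qed.

(** Otherwise the sets [S i] minus [U] are nonempty, closed and decreasing; a common point would be
    1, which lies in [U]. *)
Lemma filtration_eventually (G : topologicalGroupType) (S : nat -> set G) (U : set G) :
  compact [set: G] -> filtration_series S -> open U -> U 1 ->
  exists i0, forall i, (i0 <= i)%N -> S i `<=` U.
Proof.
move=> cG fS oU U1; have [S0 dS oS iS] := fS.
apply: contrapT => /forallNP h.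
have [||i|z zS] := @compact_decreasing _ (fun i => S i `&` ~` U) cG.
- move=> i; apply: closedI; last by rewrite closedC.
  by have [oi [si _]] := oS i; exact (open_subgroup_closed oi si).
- by move=> i; exact: setSI.
- apply: contrapT => /set0P/negP; rewrite negbK => /eqP e.
  apply: (h i) => j ij g Sg; apply: contrapT => nUg.
  have : (S i `&` ~` U) g by split=> //; exact (filtration_decreasing fS ij Sg).
  by rewrite e.
- have : (\bigcap_i S i) z by move=> i _; exact: (zS i).1.
  by rewrite iS => /= z1; case: (zS 0%N) => _; rewrite z1.
Qed.
End Filtration.

Section Cover.
Local Open Scope classical_set_scope.
Local Open Scope group_scope.
Variables (p : nat) (G : topologicalGroupType) (x y : G) (Z : set G).
Variables (tau : forall k, G -> 'Z_(p ^ k.+1)) (V : nat -> set G).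
Hypotheses (p_prime : prime p) (cov : central_wreath_cover x y Z tau V).

(* The preimage of the base group; only its inclusion of [Hsub] is needed. *)
Definition base_set : set G := [set g | forall k, tau k g = 0%R].

Lemma tauV k a : tau k a^-1 = (- tau k a)%R.
Proof.
apply/eqP; rewrite -addr_eq0 -(cwc_tauM cov) mulVg; apply/eqP.
by apply: (@addrI _ (tau k 1)); rewrite -(cwc_tauM cov) mulg1 addr0.
Qed.

Lemma tau1 k : tau k 1 = 0%R.
Proof. by rewrite -(mulgV 1) (cwc_tauM cov) tauV subrr. Qed.

Lemma tauJ k a b : tau k (a ^ b) = tau k a.
Proof. by rewrite /conjg !(cwc_tauM cov) tauV addrC addrK. Qed.

Lemma tauR k a b : tau k [~ a, b] = 0%R.
Proof. by rewrite commgEl (cwc_tauM cov) tauV tauJ addNr. Qed.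

Lemma tau_normal k : is_normal (tau k @^-1` [set 0%R]).
Proof.
split; last by move=> a b /=; rewrite tauJ.
split; first exact: tau1.
by move=> a b /= a0 b0; rewrite (cwc_tauM cov) tauV a0 b0 subr0.
Qed.

Lemma base_normal : is_normal base_set.
Proof.
split; last by move=> a b ha k; rewrite tauJ.
split=> [k|a b ha hb k]; first exact: tau1.
by rewrite (cwc_tauM cov) tauV ha hb subr0.
Qed.

Lemma center_normal : is_normal Z.
Proof.
split; first exact: cwc_subgroup cov.
by move=> a b Za; rewrite /conjg (cwc_central cov b Za) mulKg.
Qed.

Section Quotient.
Variables (gT : finGroupType) (rho : G -> gT) (U : set G).
Hypotheses (fq : finite_quotient_map p rho U) (oU : open U) (nU : is_normal U).
Let rM := fqm_morph fq.

Definition img (K : set G) (sK : is_subgroup K) : {group gT} := Group (fimage_group rM sK).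

Lemma img_normal (K : set G) (nK : is_normal K) : normal (img nK.1) [set: gT]%SET.
Proof.
rewrite /normal finset.subsetT; apply/fintype.subsetP=> z _.
have [b <-] := fqm_onto fq z; rewrite inE; apply/fintype.subsetP=> w.
rewrite mem_conjg => /fimageP[a Ka e]; apply/fimageP; exists (a ^ b).
  exact (is_normalJ b nK Ka).
by rewrite morphgJ // e conjgKV.
Qed.

Lemma quotient_gen : [set: gT]%SET \subset <<[set rho x; rho y]%SET>>%g.
Proof.
pose T := [set g | rho g \in <<[set rho x; rho y]%SET>>%g].
have T1 : T = setT.
  apply: (cwc_gen cov oU nU).
  - by move=> u /(fqm_ker fq) e; rewrite /T /= e group1.
  - split; first by rewrite /T /= morphg1 // group1.
    by move=> a b; rewrite /T /= rM morphgV // => ha hb; rewrite groupM ?groupV.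
  - by rewrite /T /= mem_gen // !inE eqxx.
  - by rewrite /T /= mem_gen // !inE eqxx orbT.
apply/fintype.subsetP=> z _; have [g <-] := fqm_onto fq z.
by have : T g by rewrite T1.
Qed.

(* Modulo the kernel of [tau e], for [e] large, a power of [x] in [base_set * U]
   already lies in [U]. *)
Lemma base_sub : img base_normal.1 \subset
  ([~: img base_normal.1, [set: gT]%SET] * <[rho y]>)%g.
Proof.
pose N := [~: img base_normal.1, [set: gT]%SET]; pose D0 := N <*> <[rho y]>%g.
have nH := img_normal base_normal.
have nN : normal N [set: gT]%SET := normal_commg nH.
have yH : rho y \in img base_normal.1.
  by apply: mem_fimage => k; exact: cwc_tau_y cov k.
have sDH : D0 \subset img base_normal.1.
  by rewrite join_subG cycle_subG yH commg_subl normal_norm.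
have DE : (N * <[rho y]> = D0)%g.
  by rewrite -norm_joinEr // cycle_subG (fintype.subsetP (normal_norm nN)) ?inE.
(* A subgroup between [N] and the image of the base is normal, since [N] contains all commutators of
   that image with the group. *)
have DJ d g : d \in D0 -> d ^ g \in D0.
  move=> dD; rewrite -[d ^ g](mulKVg d) -commgEl groupM //.
  apply: (fintype.subsetP (joing_subl _ _)).
  by apply: mem_commg; [exact: (fintype.subsetP sDH)|rewrite inE].
have [e cardE] : exists e, #|[set: gT]%SET| = (p ^ e)%N.
  by case/p_natP: (fqm_pgroup fq) => e ->; exists e.
(* This is the modulus of [tau e], and the order [p ^ e] of the group divides it: an exponent of [x]
   that [tau e] sends to 0 is also killed by [rho]. *)
pose M := (p ^ e.+1)%N.
have M0 : (0 < M)%N by rewrite expn_gt0 prime_gt0.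
have M1 : (1 < M)%N by rewrite -(exp1n e.+1) ltn_exp2r // prime_gt1.
have rxM n : M %| n -> rho (x ^+ n) = 1.
  move=> Mn; rewrite morphgX //; apply/eqP; rewrite -order_dvdn.
  apply: dvdn_trans (order_dvdG (finset.in_setT _)) _.
  by apply: dvdn_trans Mn; rewrite cardE dvdn_exp2l.
have txX n : tau e (x ^+ n) = n%:R%R.
  elim: n => [|n ih]; first by rewrite expg0 tau1.
  by rewrite expgS (cwc_tauM cov) ih (cwc_tau_x cov) -natr1 addrC.
pose D := [set g | tau e g = 0%R /\ rho g \in D0].
have sD : is_subgroup D.
  split; first by rewrite /D /= tau1 morphg1 // group1.
  move=> a b [a0 ha] [b0 hb]; rewrite /D /= (cwc_tauM cov) tauV a0 b0 subr0.
  by rewrite rM morphgV // groupM ?groupV.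
have nD a b : D a -> D (a ^ b).
  by move=> [a0 ha]; rewrite /D /= tauJ morphgJ //; split=> //; exact: DJ.
have xMD n : M %| n -> D (x ^+ n).
  move=> Mn; split; last by rewrite rxM // group1.
  by rewrite txX; apply/eqP; rewrite natr_Zp0.
pose T := [set g | exists n d, D d /\ g = x ^+ n * d].
have TT : T = setT.
  apply: (@cwc_gen _ _ _ _ _ _ _ cov _ (U `&` tau e @^-1` [set 0%R])).
  - by apply: openI => //; exact: cwc_tau_open cov e.
  - by apply: is_normalI => //; exact: tau_normal.
  - move=> u [Uu u0]; exists 0%N, u; rewrite expg0 mul1g; split=> //; split=> //.
    by move/(fqm_ker fq): Uu => ->; exact: group1.
  - apply: is_subgroupM.
    + by exists 0%N, 1; rewrite expg0 mulg1; split=> //; exact: subgroup1.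
    + move=> _ _ [n [d [Dd ->]]] [n' [d' [Dd' ->]]].
      exists (n + n')%N, (d ^ (x ^+ n') * d'); split.
        by apply: subgroupM => //; exact: nD.
      by rewrite expgnDr /conjg !mulgA mulgK.
    + move=> _ [n [d [Dd ->]]].
      (* Only natural exponents are allowed in [T]: [x ^- n] is [x ^+ (M * n - n)] times
         [x ^- (M * n)], and the latter lies in [D]. *)
      exists (M * n - n)%N, (x ^- (M * n) * d^-1 ^ (x ^- n)); split.
        apply: subgroupM => //; first by apply: subgroupV => //; apply: xMD; exact: dvdn_mulr.
        by apply: nD; exact: subgroupV.
      have -> : x ^+ (M * n) = x ^+ n * x ^+ (M * n - n).
        by rewrite -expgnDr subnKC // leq_pmull.
      by rewrite /conjg invgK !invgM !mulgA mulgV mul1g mulVg mul1g.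
  - by exists 1%N, 1; rewrite expg1 mulg1; split=> //; exact: subgroup1.
  - exists 0%N, y; rewrite expg0 mul1g; split=> //; split; first exact: cwc_tau_y cov e.
    by apply: (fintype.subsetP (joing_subr _ _)); exact: cycle_id.
rewrite -/N DE; apply/fintype.subsetP=> _ /fimageP[h hB <-].
have [n [d [[d0 dD] E]]] : T h by rewrite TT.
rewrite E rM rxM ?mul1g //.
have := hB e; rewrite E (cwc_tauM cov) d0 addr0 txX => /eqP.
by rewrite natr_Zp0.
Qed.
End Quotient.


(* [K] not inside [Z] moves some generator modulo [Z], so [[K, G]] is nontrivial
   in some finite wreath product, where the lower series of the base dies. *)
Lemma card_base_le (S : nat -> set G) (K : set G) :
  filtration_series S -> is_normal K -> ~ K `<=` Z ->
  exists C i0, (0 < C)%N /\ forall i, (i0 <= i)%N ->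
    forall (gT : finGroupType) (rho : G -> gT), finite_quotient_map p rho (S i) ->
    (#|fimage rho base_set| <= C * #|[~: fimage rho K, [set: gT]%SET]%g|)%N.
Proof.
move=> fS nK KZ; have [_ _ oS _] := fS.
have [a [g [Ka ag gxy]]] : exists a g, [/\ K a, ~ Z [~ a, g] & g = x \/ g = y].
  have /existsNP[a /not_implyP[Ka nZa]] := KZ.
  have /not_andP[h|h] := cwc_center cov nZa.
    by exists a, x; split=> //; left.
  by exists a, y; split=> //; right.
have [k nVk] : exists k, ~ V k [~ a, g].
  by apply/existsNP => h; apply: ag; apply/(cwc_ker cov).
have [oV nV] := cwc_open cov k.
have [gT' [rho' fq']] := cwc_quotient cov oV nV.
have [c Lc] := lower_series_nil (pgroup_nil (fqm_pgroup fq'))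
  (img_normal fq' base_normal).
have [i0 hi0] := filtration_eventually (cwc_compact cov) fS oV (subgroup1 nV.1).
(* This is the factor of [card_lower_series] with [p ^ 2] as bound for the first step: modulo that
   step the base is generated by [y], and [y ^+ p] lies in [Z], which has exponent [p]. *)
exists (\prod_(k < c) (p ^ 2) ^ (2 ^ k))%N, i0; split.
  by rewrite prodn_gt0 // => j; rewrite !expn_gt0 prime_gt0.
move=> i i0i gT rho fq; have [oi ni] := oS i.
have rM := fqm_morph fq.
pose H := img fq base_normal.1; pose Kr := img fq nK.1.
pose Zr := img fq center_normal.1.
have nH : normal H [set: gT]%G := img_normal fq base_normal.
have nKr : normal Kr [set: gT]%G := img_normal fq nK.
have gen : [set: gT]%SET \subset <<[set rho x; rho y]%SET>>%g := quotient_gen fq oi ni.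
have inT (z : gT) : z \in [set: gT]%G by rewrite inE.
have yp2 : rho y ^+ (p ^ 2) = 1.
  rewrite -(morphgX _ rM) expnS expn1 expgnA (cwc_exponent cov) ?morphg1 //.
  exact: cwc_yX cov.
have sH := base_sub fq oi ni.
have sRH : [~: H, [set: gT]%G] \subset H by rewrite commg_subl normal_norm.
have iH : (#|H : [~: H, [set: gT]%G]| <= p ^ 2)%N.
  apply: leq_trans (index_mul_cycle sRH sH) _.
  by apply: dvdn_leq; rewrite ?expn_gt0 ?prime_gt0 // order_dvdn yp2.
(* The lemma is applied to [[K, G]], which lies in the base even if [K] does not. *)
have sL : lower_series H [set: gT]%G c \subset [~: Kr, [set: gT]%G]%G.
  apply: (lower_series_sub_normal (Z := Zr) (x := rho x) (y := rho y) p_prime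
    (fqm_pgroup fq)) => //.
  - rewrite finset.subsetI finset.subsetT; apply/centsP => _ /fimageP[z Zz <-] w _.
    have [b <-] := fqm_onto fq w.
    by rewrite /commute -!rM (cwc_central cov b Zz).
  - move=> _ /fimageP[b Bb <-]; rewrite -morphgR //; apply: mem_fimage.
    by apply: (cwc_abelian cov) => // j; exact: cwc_tau_y cov j.
  - by rewrite -(morphgX _ rM); apply: mem_fimage; exact: cwc_yX cov.
  - exact: normal_commg.
  - rewrite gen_subG; apply/fintype.subsetP=> _ /imset2P[_ w /fimageP[b Kb <-] _ ->].
    have [d <-] := fqm_onto fq w.
    by rewrite -morphgR //; apply: mem_fimage => j; exact: tauR.
  apply/negP => /fintype.subsetP/(_ (rho [~ a, g])); rewrite morphgR //.
  move=> /(_ _)/mulsgP[|l z lL]; first by rewrite mem_commg // mem_fimage.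
  have rr b d : rho b = rho d -> rho' b = rho' d.
    move=> /(morphg_eq rM (fqm_ker fq)) h.
    by apply/(morphg_eq (fqm_morph fq') (fqm_ker fq')); exact: hi0 h.
  (* The induced map from [G / S i] to [G / V k], which exists because [S i] lies in [V k]. It kills
     both [Z] and term [c] of the series, but not [[~ a, g]]. *)
  pose f w := rho' (projT1 (cid (fqm_onto fq w))).
  have fE b : f (rho b) = rho' b by rewrite /f; case: cid => d /= /rr.
  have fM : {in [set: gT]%G &, {morph f : a b / a * b}}.
    move=> u v _ _; have [b <-] := fqm_onto fq u; have [d <-] := fqm_onto fq v.
    by rewrite -rM !fE (fqm_morph fq').
  pose fm := Morphism fM.
  have fH : (fm @* H)%G = img fq' base_normal.1.
    apply/val_inj/setP => w /=; apply/morphimP/fimageP.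
      by move=> [_ _ /fimageP[b Bb <-] ->]; exists b => //; rewrite /= fE.
    by move=> [b Bb <-]; exists (rho b); [exact: inT|exact: mem_fimage|by rewrite /= fE].
  have fT : (fm @* [set: gT])%G = [set: gT']%G.
    apply/val_inj/setP => w /=; rewrite inE; apply/morphimP.
    by have [b <-] := fqm_onto fq' w; exists (rho b); rewrite ?inE //= fE.
  have f1 : f l = 1.
    have : fm l \in (fm @* lower_series H [set: gT]%G c)%g by rewrite mem_morphim.
    by rewrite morphim_lower_series // fH fT Lc => /set1P.
  move=> /fimageP[b Zb <-] E; apply: nVk; apply/(fqm_ker fq').
  rewrite -fE morphgR // E fM // f1 mul1g fE; apply/(fqm_ker fq').
  by move/(cwc_ker cov): Zb; apply.
apply: leq_trans (card_lower_series c nH gen (inT _) (inT _)) _.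
rewrite mulnC leq_mul ?subset_leq_card //.
by apply: leq_prod => j _; rewrite leq_exp2r // expn_gt0.
Qed.
End Cover.

(** * Subgroups of Z of prescribed density *)

Section Construction.
Local Open Scope classical_set_scope.
Local Open Scope group_scope.
Variables (p : nat) (G : topologicalGroupType) (x y : G) (Z : set G).
Variables (tau : forall k, G -> 'Z_(p ^ k.+1)) (V : nat -> set G).
Hypotheses (p_prime : prime p) (cov : central_wreath_cover x y Z tau V).

Lemma index_fimage (gT : finGroupType) (rho : G -> gT) (U A : set G) :
  finite_quotient_map p rho U -> is_subgroup U -> Defs.index A U = #|fimage rho A|.
Proof.
move=> fq sU; apply: card_fimage_index => //.
exact: morphg_eq (fqm_morph fq) (fqm_ker fq).
Qed.

(** This is Lagrange in the quotient by [U']; since [U'] lies in [U], the image of [A] and [U]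
    intersected is the intersection of the two images. *)
Lemma index_mul_fimage (gT : finGroupType) (rho : G -> gT) (U U' A : set G) :
  finite_quotient_map p rho U' -> is_normal U -> U' `<=` U -> is_subgroup A ->
  (Defs.index A U * #|fimage rho (A `&` U)| = #|fimage rho A|)%N.
Proof.
move=> fq nU sU' sA; have rM := fqm_morph fq.
pose N := img fq nU.1; pose f (g : G) := coset N (rho g).
have rN g : rho g \in 'N(N).
  by case/andP: (img_normal fq nU) => _ /fintype.subsetP; apply; rewrite inE.
have rU g : (rho g \in N) <-> U g.
  split=> [/fimageP[u Uu /(morphg_eq rM (fqm_ker fq))/sU' h]|]; last exact: mem_fimage.
  by rewrite -[g](mulKVg u); apply: subgroupM nU.1 _ _.
have fM : {morph f : a b / a * b} by move=> a b; rewrite /f rM morphM ?rN.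
have fU g : f g = 1 <-> U g.
  rewrite -rU; split; [exact: coset_idr|exact: coset_id].
rewrite (card_fimage_index A nU.1 (morphg_eq fM fU)).
have -> : fimage f A = (img fq sA / N)%g.
  apply/setP => z; apply/fimageP/morphimP => [[a Aa <-]|[_ _ /fimageP[a Aa <-] ->]].
    by exists (rho a); [exact: rN|exact: mem_fimage|].
  by exists a.
rewrite card_quotient; last by apply/fintype.subsetP => _ /fimageP[a _ <-].
rewrite mulnC -(LagrangeI (img fq sA) N); congr (#|pred_of_set _| * _)%N.
apply/setP => z; rewrite finset.in_setI; apply/fimageP/andP => [[a [Aa Ua] <-]|].
  by split; exact: mem_fimage.
case=> /fimageP[a Aa <-] /rU Ua; by exists a.
Qed.

(** An approximation of the required subgroup that is correct up to level [i]. It contains all of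
    [Z] inside [S i], so that every choice below that level remains open. *)
Record level_subgroup (S : nat -> set G) (f : nat -> nat) (i : nat) (U : set G) : Prop := {
  level_group : is_subgroup U;
  level_closed : closed U;
  level_center : U `<=` Z;
  level_incl : Z `&` S i `<=` U;
  level_index : Defs.index U (S i) = (p ^ f i)%N }.

(** Modulo [S i.+1] the image [E] of [U] is elementary abelian, hence splits over the image [N0] of
    [Z] inside [S i]. The complement [C] has order [p ^ f i] and covers [U] modulo [S i]. Joining to
    it a subgroup of [N0] of order [p ^ (f i.+1 - f i)] gives the next index; [N0] is large enough
    because [f] grows no faster than [d]. *)
Lemma level_step (S : nat -> set G) (f d : nat -> nat) (i : nat) (U : set G) :
  filtration_series S -> (forall i, Defs.index Z (S i) = (p ^ d i)%N) ->
  (f i <= f i.+1 <= f i + (d i.+1 - d i))%N ->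
  level_subgroup S f i U ->
  exists U', [/\ level_subgroup S f i.+1 U', U' `<=` U &
    forall u, U u -> exists2 u', U' u' & S i (u^-1 * u')].
Proof.
move=> fS dE /andP[f1 f2] [sU cU UZ ZU iU].
have [_ dS oS _] := fS; have [oi ni] := oS i; have [oi1 ni1] := oS i.+1.
have sZ := cwc_subgroup cov.
have [gT [rho fq]] := cwc_quotient cov oi1 ni1.
have rM := fqm_morph fq.
pose E := img fq sU; pose N0 := img fq (is_subgroupI sZ ni.1).
have p1 := prime_gt1 p_prime.
have UE : U `&` S i = Z `&` S i.
  apply/seteqP; split=> g [h1 h2]; split=> //; [exact: UZ|exact: ZU].
have cN0 : #|N0| = (p ^ (d i.+1 - d i))%N.
  apply/eqP; rewrite -(eqn_pmul2l (m := p ^ d i)) ?expn_gt0 ?prime_gt0 //.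
  have := index_mul_fimage fq ni (dS i) sZ.
  rewrite -(index_fimage Z fq ni1.1) !dE => E1.
  have le : (d i <= d i.+1)%N.
    by rewrite -(leq_exp2l _ _ p1) -E1 leq_pmulr // (cardG_gt0 N0).
  by rewrite -expnD subnKC // -E1.
have cE : #|E| = (p ^ (f i + (d i.+1 - d i)))%N.
  have := index_mul_fimage fq ni (dS i) sU.
  by rewrite UE iU expnD -cN0 => ->.
have sN0E : N0 \subset E by rewrite /= fimageS.
have abE : p.-abelem E.
  apply/abelemP => //; split.
    apply/centsP => _ /fimageP[a Ua <-] _ /fimageP[b Ub <-].
    by rewrite /commute -!rM (cwc_central cov b (UZ _ Ua)).
  move=> _ /fimageP[a Ua <-].
  by rewrite -(morphgX _ rM) (cwc_exponent cov (UZ _ Ua)) morphg1.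
have /splitsP[C /complP[tiNC NC]] := abelem_splits abE sN0E.
have cC : #|C| = (p ^ f i)%N.
  apply/eqP; rewrite -(eqn_pmul2l (m := #|N0|)) ?cardG_gt0 // -TI_cardMg // NC.
  by rewrite cE cN0 -expnD addnC.
have pN0 : p.-group N0 := pgroupS sN0E (abelem_pgroup abE).
have [N1 [sN1 _ cN1]] : exists N1 : {group gT},
    [/\ N1 \subset N0, normal N1 N0 & #|N1| = (p ^ (f i.+1 - f i))%N].
  apply: normal_pgroup => //.
  by rewrite cN0 pfactorK // leq_subLR.
have tiN1C : N1 :&: C = 1.
  by apply/trivgP; rewrite -tiNC finset.setSI.
have sCE : C \subset E by rewrite -NC mulG_subr.
have sN1E : N1 \subset E := fintype.subset_trans sN1 sN0E.
have AE : N1 * C = N1 <*> C.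
  rewrite -norm_joinEr // cents_norm //.
  exact: (fintype.subset_trans sCE (fintype.subset_trans (abelem_abelian abE) (centS sN1E))).
pose A := (N1 <*> C)%G.
have sAE : A \subset E by rewrite join_subG sN1E.
pose U' := U `&` [set g | rho g \in A].
have sP : is_subgroup [set g | rho g \in A].
  split; first by rewrite /= morphg1 // group1.
  by move=> a b /= ha hb; rewrite rM morphgV // groupM ?groupV.
have imU' : fimage rho U' = A.
  apply/setP => z; apply/fimageP/idP => [[a [_ ?] <-] //|zA].
  have /fimageP[a Ua ea] := fintype.subsetP sAE z zA.
  by exists a => //; split => //=; rewrite ea.
exists U'; split.
- split.
  + exact: is_subgroupI.
  + apply: closedI => //.
    have oP : open [set g | rho g \in A].
      apply: (open_coset_union oi1 ni1.1) => a u /= ha /(fqm_ker fq) e.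
      by rewrite rM e mulg1.
    exact (open_subgroup_closed oP sP).
  + by move=> g [Ug _]; exact: UZ.
  + move=> g [Zg Sg]; split; first by apply: ZU; split=> //; exact: dS.
    by move/(fqm_ker fq): Sg => /= ->; exact: group1.
  + rewrite (index_fimage _ fq ni1.1) imU' /= -AE TI_cardMg // cN1 cC -expnD subnK //.
- by move=> g [].
- move=> u Uu.
  have : rho u \in E by exact: mem_fimage.
  rewrite -NC => /mulsgP[_ c /fimageP[s [Zs Ss] <-] cC' E1].
  exists (s^-1 * u).
    split; first by apply: subgroupM => //; apply: subgroupV => //; exact: ZU.
    rewrite /= rM morphgV // E1 mulKg; apply: (fintype.subsetP (joing_subr _ _)) => //.
  rewrite (cwc_central cov u (subgroupV sZ Zs)) mulKg.
  exact (subgroupV ni.1 Ss).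
Qed.

Lemma center_closed : closed Z.
Proof.
rewrite (_ : Z = \bigcap_k V k).
  apply: closed_bigI => k _; have [oV nV] := cwc_open cov k.
  exact (open_subgroup_closed oV nV.1).
apply/seteqP; split=> [g /(cwc_ker cov) h k _ //|g h].
by apply/(cwc_ker cov) => k; exact: h.
Qed.

(** The subgroup is the intersection of the successive approximations. Intersecting could lose
    elements modulo [S i]; but an element of the approximation at level [i] lifts, within its coset
    of [S i], to every later one, and compactness supplies a common lift. *)
Lemma central_subgroup_exists (S : nat -> set G) (f d : nat -> nat) :
  filtration_series S -> (forall i, Defs.index Z (S i) = (p ^ d i)%N) -> f 0%N = 0%N ->
  (forall i, (f i <= f i.+1 <= f i + (d i.+1 - d i))%N) ->
  exists L, [/\ is_subgroup L, closed L, L `<=` Z &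
    forall i, Defs.index L (S i) = (p ^ f i)%N].
Proof.
move=> fS dE f0 fd; have [S0 dS oS _] := fS.
(* The level condition stands inside the existential so that [choice] yields a total function;
   [set0] is the junk value where the condition fails. *)
have step (iU : nat * set G) : exists U', level_subgroup S f iU.1 iU.2 ->
    [/\ level_subgroup S f iU.1.+1 U', U' `<=` iU.2 &
      forall u, iU.2 u -> exists2 u', U' u' & S iU.1 (u^-1 * u')].
  have [h|h] := pselect (level_subgroup S f iU.1 iU.2); last by exists set0.
  by have [U' hU'] := level_step fS dE (fd iU.1) h; exists U'.
have [F FP] := choice step.
pose U := fix U i := if i is j.+1 then F (j, U j) else Z.
have lU i : level_subgroup S f i (U i).
  elim: i => [|i ih]; last by have [] := FP (i, U i) ih.
  split; [exact: cwc_subgroup cov|exact: center_closed|by []|by move=> g []|].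
  rewrite f0 expn0 S0.
  have sT : is_subgroup [set: G] by [].
  rewrite (card_fimage_index (f := fun=> tt) _ sT) //.
  rewrite (_ : fimage _ _ = [set tt]%SET) ?cards1 //; apply/setP => -[].
  rewrite [RHS]inE eqxx; apply/fimageP; exists 1 => //.
  exact: (cwc_subgroup cov).1.
have dU i : U i.+1 `<=` U i by have [] := FP (i, U i) (lU i).
have nU i u : U i u -> exists2 u', U i.+1 u' & S i (u^-1 * u').
  by have [_ _] := FP (i, U i) (lU i); apply.
have dU' i j : (i <= j)%N -> U j `<=` U i.
  move=> /subnK <-; elim: (j - i)%N => // e ih; exact: subset_trans (dU _) ih.
exists (\bigcap_i U i); split.
- split=> [i _|a b ha hb i _]; first exact: subgroup1 (level_group (lU i)).
  exact: (level_group (lU i)).2 (ha i I) (hb i I).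
- by apply: closed_bigI => i _; exact: level_closed (lU i).
- by move=> g /(_ 0%N I).
- move=> i; rewrite -(level_index (lU i)).
  have [oi ni] := oS i.
  have [gT [rho fq]] := cwc_quotient cov oi ni.
  rewrite !(index_fimage _ fq ni.1); congr #|pred_of_set _|.
  apply/eqP; rewrite finset.eqEsubset; apply/andP; split.
    by apply: fimageS => g; exact.
  apply/fintype.subsetP => _ /fimageP[u Uu <-].
  pose C j := U (i + j)%N `&` [set g | S i (u^-1 * g)].
  have [||j|l lC] := @compact_decreasing G C (cwc_compact cov).
  + move=> j; apply: closedI; first exact: level_closed (lU _).
    apply: (@closed_comp _ _ (fun g : G => u^-1 * g)); last exact (open_subgroup_closed oi ni.1).
    by move=> g _; exact: continuous_mulgl.
  + by move=> j; rewrite /C addnS; exact: setSI.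
  + elim: j => [|j [v [Uv Sv]]].
      by exists u; rewrite /C addn0; split=> //=; rewrite mulVg; exact: subgroup1 ni.1.
    have [w Uw Sw] := nU _ _ Uv; exists w; rewrite /C addnS; split=> //=.
    rewrite -[w](mulKVg v) mulgA; apply: subgroupM ni.1 Sv _.
    exact (filtration_decreasing fS (leq_addr j i) Sw).
  apply/fimageP; exists l.
    by move=> j _; have [h _] := lC j; exact: dU' (leq_addl i j) _ h.
  have [_ /= Sl] := lC 0%N; apply/esym/(morphg_eq (fqm_morph fq) (fqm_ker fq)) => //.
Qed.
End Construction.

(** * Direct powers *)

Section Product.
Local Open Scope classical_set_scope.
Local Open Scope group_scope.

Lemma card_family_prod (m : nat) (gT : finType) (F : 'I_m -> {set gT}) :
  #|finset (fun w : {ffun 'I_m -> gT} => [forall j, w j \in F j])| = (\prod_j #|F j|)%N.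
Proof.
have -> : #|finset (fun w : {ffun 'I_m -> gT} => [forall j, w j \in F j])|
    = #|(family (fun j => mem (F j)) : simpl_pred {ffun 'I_m -> gT})|.
  by rewrite cardsE; apply: eq_card => w; apply/forallP/familyP.
by rewrite card_family foldrE big_map big_enum.
Qed.

Lemma prod_if (m : nat) (J : {set 'I_m}) (a b : nat) :
  (\prod_j (if j \in J then a else b) = a ^ #|J| * b ^ (m - #|J|))%N.
Proof.
rewrite (bigID (fun j => j \in J)) /=; congr (_ * _)%N.
  by rewrite (eq_bigr (fun=> a)) ?prod_nat_const // => j ->.
rewrite (eq_bigr (fun=> b)) => [|j /negPf->//].
have E := cardC J; rewrite card_ord in E.
rewrite prod_nat_const -[X in (X - _)%N]E addKn; congr (_ ^ _)%N.
Qed.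

Variables (p : nat) (G : topologicalGroupType) (m : nat) (S : nat -> set G).
Hypothesis fS : filtration_series S.

Lemma filtration_pow_normal i : is_normal (filtration_pow S m i).
Proof.
have [_ _ /(_ i)[_ [[S1 SV] nS]] _] := fS.
split; last by move=> a b Sa j; exact: nS.
by split=> [j|a b Sa Sb j]; [exact: S1|exact: SV].
Qed.

Definition ffun_map (gT : finType) (rho : G -> gT) (g : gpow G m) : {ffun 'I_m -> gT} :=
  [ffun j => rho (g j)].

Lemma index_pow (gT : finGroupType) (rho : G -> gT) (i : nat) (K : set (gpow G m)) :
  finite_quotient_map p rho (S i) ->
  Defs.index (setmul K (filtration_pow S m i)) (filtration_pow S m i)
  = #|fimage (ffun_map rho) K|.
Proof.
move=> fq; have nSm := filtration_pow_normal i.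
rewrite index_setmul; last exact: nSm.1.
apply: card_fimage_index; first exact: nSm.1.
move=> a b; split=> [/ffunP e j|h].
  by have := e j; rewrite !ffunE => /(morphg_eq (fqm_morph fq) (fqm_ker fq)).
apply/ffunP => j; rewrite !ffunE; apply/(morphg_eq (fqm_morph fq) (fqm_ker fq)).
exact: h.
Qed.

Lemma index_pow_setT (gT : finGroupType) (rho : G -> gT) (i : nat) :
  finite_quotient_map p rho (S i) ->
  Defs.index setT (filtration_pow S m i) = (Defs.index setT (S i) ^ m)%N.
Proof.
move=> fq; have [_ _ /(_ i)[_ nS] _] := fS; have nSm := filtration_pow_normal i.
have -> : Defs.index setT (filtration_pow S m i) = #|fimage (ffun_map rho) setT|.
  rewrite -(index_pow _ fq); congr Defs.index.
  apply/seteqP; split=> // g _; exists g => //; exists 1; rewrite ?mulg1 //.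
  exact: subgroup1 nSm.1.
rewrite (index_fimage _ fq nS.1).
have -> : fimage rho setT = [set: gT]%SET.
  by apply/setP => z; rewrite [RHS]inE; have [g <-] := fqm_onto fq z; exact: mem_fimage.
have -> : fimage (ffun_map rho) setT = [set: {ffun 'I_m -> gT}]%SET.
  apply/setP => w; rewrite [RHS]inE; have [g gw] := choice (fun j => fqm_onto fq (w j)).
  by apply/fimageP; exists g => //; apply/ffunP => j; rewrite ffunE.
by rewrite !cardsT card_ffun card_ord.
Qed.

(** This is the direct product of [l] copies of [G], in the first coordinates, and [m - l] copies of
    [L]. *)
Definition box (l : nat) (L : set G) : set (gpow G m) :=
  [set g | forall j : 'I_m, (j < l)%N \/ L (g j)].

Lemma index_box (gT : finGroupType) (rho : G -> gT) (i l : nat) (L : set G) :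
  finite_quotient_map p rho (S i) -> (l <= m)%N -> L 1 ->
  Defs.index (setmul (box l L) (filtration_pow S m i)) (filtration_pow S m i)
  = (Defs.index setT (S i) ^ l * Defs.index L (S i) ^ (m - l))%N.
Proof.
move=> fq lm L1; have [_ _ /(_ i)[_ nS] _] := fS.
rewrite (index_pow _ fq) !(index_fimage _ fq nS.1).
pose J := finset (fun j : 'I_m => (j < l)%N).
have cJ : #|J| = l.
  rewrite cardsE -sum1_card big_mkcond /=.
  rewrite -(big_mkord xpredT (fun j => if (j < l)%N then 1%N else 0%N)).
  rewrite (big_cat_nat (n := l)) //= [X in (_ + X)%N]big1_seq ?addn0.
    rewrite (eq_big_nat _ _ (F2 := fun=> 1%N)) => [|j /andP[_ ->] //].
    by rewrite sum_nat_const_nat subn0 muln1.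
  by move=> j; rewrite mem_index_iota /= => /andP[lj _]; rewrite ltnNge lj.
rewrite -{2 3}cJ -prod_if.
transitivity (\prod_(j < m) #|if j \in J then fimage rho setT else fimage rho L|)%N;
  last by apply: eq_bigr => j _; case: ifP.
rewrite -card_family_prod; congr #|pred_of_set _|; apply/setP => w.
rewrite [RHS]inE; apply/fimageP/forallP => [[g gB <-] j|h].
  rewrite ffunE inE; case: ifP => [_|/negbT jl]; first exact: mem_fimage.
  by apply: mem_fimage; case: (gB j) => // jl'; rewrite jl' in jl.
have ex (j : 'I_m) : exists a, ((j < l)%N \/ L a) /\ rho a = w j.
  have := h j; rewrite inE; case: ifP => [jl|_] /fimageP[a La e]; exists a; split=> //.
    by left.
  by right.
have [g gP] := choice ex; exists g; first by move=> j; exact: (gP j).1.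
by apply/ffunP => j; rewrite ffunE; exact: (gP j).2.
Qed.

Lemma box_normal (l : nat) (L : set G) : is_normal L -> is_normal (box l L).
Proof.
move=> [[L1 LV] nL]; split; first split.
- by move=> j; right.
- move=> a b ha hb j; have [jl|La] := ha j; first by left.
  by have [jl|Lb] := hb j; [left|right; exact: LV].
- by move=> a b ha j; have [jl|La] := ha j; [left|right; exact: nL].
Qed.

Lemma box_closed (l : nat) (L : set G) : closed L -> closed (box l L).
Proof.
move=> cL; rewrite (_ : box l L =
    \bigcap_(j in [set j : 'I_m | ~~ (j < l)%N]) ((fun g : gpow G m => g j) @^-1` L)).
  apply: closed_bigI => j _; apply: closed_comp => // g _.
  exact: (@gprod_proj_continuous _ (fun=> G) j).
apply/seteqP; split=> [g h j /= jl|g h j].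
  by case: (h j) => // jl'; rewrite jl' in jl.
by case: (ltnP j l) => jl; [left|right; apply: h; rewrite /= -leqNgt].
Qed.
End Product.

(** * Normal subgroups of the direct power *)

Section NormalBounds.
Local Open Scope classical_set_scope.
Local Open Scope group_scope.
Variables (p : nat) (G : topologicalGroupType) (x y : G) (Z : set G).
Variables (tau : forall k, G -> 'Z_(p ^ k.+1)) (V : nat -> set G).
Hypotheses (p_prime : prime p) (cov : central_wreath_cover x y Z tau V).
Variables (m : nat) (S : nat -> set G).
Hypothesis fS : filtration_series S.

Definition coordinate (K : set (gpow G m)) (j : 'I_m) : set G := [set g j | g in K].

Lemma coordinate_normal (K : set (gpow G m)) (j : 'I_m) : is_normal K -> is_normal (coordinate K j).
Proof.
move=> [[K1 KV] nK]; split; first split; first by exists 1.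
  by move=> _ _ [a Ka <-] [b Kb <-]; exists (a * b^-1) => //; exact: KV.
by move=> _ b [a Ka <-]; exists (a ^ ((fun=> b) : gpow G m)) => //; exact: nK.
Qed.

Definition single (gT : groupType) (j : 'I_m) (a : gT) : 'I_m -> gT :=
  fun i => if i == j then a else 1.

Lemma fimage_ffun_map_mul (gT : finGroupType) (rho : G -> gT) (K : set (gpow G m))
    (u v : {ffun 'I_m -> gT}) : {morph rho : a b / a * b} -> is_subgroup K ->
  u \in fimage (ffun_map rho) K -> v \in fimage (ffun_map rho) K ->
  [ffun i => u i * v i] \in fimage (ffun_map rho) K.
Proof.
move=> rM sK /fimageP[a Ka <-] /fimageP[b Kb <-].
apply/fimageP; exists (a * b); first exact: subgroupM.
by apply/ffunP => i; rewrite !ffunE rM.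
Qed.

(** For [a] in [K] and [g] concentrated in coordinate [j], the commutator of [a] and [g] lies in [K]
    by normality and is trivial outside [j]. *)
Lemma fimage_single (gT : finGroupType) (rho : G -> gT) (i : nat) (K : set (gpow G m))
    (j : 'I_m) (v : gT) : finite_quotient_map p rho (S i) -> is_normal K ->
  v \in [~: fimage rho (coordinate K j), [set: gT]%SET]%g ->
  [ffun i => single j v i] \in fimage (ffun_map rho) K.
Proof.
move=> fq nK; have rM := fqm_morph fq.
pose D := finset (fun v => [ffun i => single j v i] \in fimage (ffun_map rho) K).
have DE u : (u \in D) = ([ffun i => single j u i] \in fimage (ffun_map rho) K).
  by rewrite [LHS]inE.
have gD : group_set D.
  apply/group_setP; split.
    rewrite DE; apply/fimageP; exists 1; first exact: subgroup1 nK.1.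
    by apply/ffunP => k; rewrite !ffunE /single if_same; exact (morphg1 rM).
  move=> u w; rewrite !DE => hu hw.
  have := fimage_ffun_map_mul rM nK.1 hu hw.
  rewrite (_ : [ffun i => _ * _] = [ffun i => single j (u * w) i]) //.
  by apply/ffunP => k; rewrite !ffunE /single; case: ifP => // _; rewrite mulg1.
suff /fintype.subsetP sD : [~: fimage rho (coordinate K j), [set: gT]%SET]%g \subset Group gD.
  by move=> /sD; rewrite DE.
rewrite gen_subG; apply/fintype.subsetP => _ /imset2P[_ w /fimageP[_ [a Ka <-] <-] _ ->].
have [g <-] := fqm_onto fq w; rewrite DE; apply/fimageP.
exists [~ a, (single j g : gpow G m)].
  rewrite commgEl; apply: subgroupM nK.1 _ _; first exact: subgroupV nK.1 Ka.
  exact: nK.2.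
apply/ffunP => k; rewrite !ffunE -morphgR // /single.
transitivity (rho [~ a k, single j g k]); first by [].
by rewrite /single; case: eqP => [->//|_]; rewrite commg1 morphg1.
Qed.

Lemma fimage_family (gT : finGroupType) (rho : G -> gT) (i : nat) (K : set (gpow G m))
    (J : {set 'I_m}) : finite_quotient_map p rho (S i) -> is_normal K ->
  finset (fun w : {ffun 'I_m -> gT} => [forall j, w j \in
    if j \in J then [~: fimage rho (coordinate K j), [set: gT]%SET]%g else 1%g])
  \subset fimage (ffun_map rho) K.
Proof.
move=> fq nK; have rM := fqm_morph fq; apply/fintype.subsetP => w.
rewrite inE => /forallP wP.
suff h (s : seq 'I_m) : uniq s ->
    [ffun j => if j \in s then w j else 1] \in fimage (ffun_map rho) K.
  have := h (enum 'I_m) (enum_uniq _); rewrite (_ : [ffun j => _] = w) //.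
  by apply/ffunP => j; rewrite ffunE mem_enum inE.
elim: s => [|j s ih] /=.
  move=> _; apply/fimageP; exists 1; first exact: subgroup1 nK.1.
  by apply/ffunP => k; rewrite !ffunE; exact (morphg1 rM).
move=> /andP[js us].
have hj : [ffun k => single j (w j) k] \in fimage (ffun_map rho) K.
  have := wP j; case: ifP => _; first exact (fimage_single fq nK).
  move=> /set1P->; apply: (fimage_single fq nK); exact: group1.
have := fimage_ffun_map_mul rM nK.1 hj (ih us).
rewrite (_ : [ffun i => _ * _] = [ffun k => if k \in j :: s then w k else 1]) //.
apply/ffunP => k; rewrite !ffunE /single inE; case: eqP => [->|_] /=.
  by rewrite (negPf js) mulg1.
by rewrite mul1g.
Qed.

Lemma normal_index_bounds (K : set (gpow G m)) : is_normal K ->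
  exists l C i0, [/\ (l <= m)%N, (0 < C)%N &
    forall i, (Defs.index (setmul K (filtration_pow S m i)) (filtration_pow S m i)
        <= Defs.index setT (S i) ^ l * Defs.index Z (S i) ^ (m - l))%N /\
      ((i0 <= i)%N -> (Defs.index (base_set tau) (S i) ^ l
        <= C * Defs.index (setmul K (filtration_pow S m i)) (filtration_pow S m i))%N)].
Proof.
move=> nK; have [_ _ oS _] := fS.
pose J := finset (fun j => `[< ~ coordinate K j `<=` Z >]).
have ex (j : 'I_m) : exists Ci : nat * nat, (0 < Ci.1)%N /\ (j \in J ->
    forall i, (Ci.2 <= i)%N ->
    forall (gT : finGroupType) (rho : G -> gT), finite_quotient_map p rho (S i) ->
    (#|fimage rho (base_set tau)| <=
     Ci.1 * #|[~: fimage rho (coordinate K j), [set: gT]%SET]%g|)%N).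
  rewrite inE; case: asboolP => [h|_]; last by exists (1%N, 0%N).
  have [C [i0 [C0 hC]]] := card_base_le p_prime cov fS (coordinate_normal j nK) h.
  by exists (C, i0).
have [Ci CiP] := choice ex.
(* Each coordinate in [J] costs its own constant and has its own starting index; the constants
   multiply and the latest start is taken. *)
exists #|J|, (\prod_(j < m | j \in J) (Ci j).1)%N, (\max_(j < m) (Ci j).2)%N; split.
- by rewrite -[m in (_ <= m)%N]card_ord max_card.
- by rewrite prodn_cond_gt0 // => j _; exact: (CiP j).1.
- move=> i; have [oi ni] := oS i.
  have [gT [rho fq]] := cwc_quotient cov oi ni.
  rewrite (index_pow fS _ fq) !(index_fimage _ fq ni.1) -prod_if; split.
    have -> : (\prod_(j < m) (if j \in J then #|fimage rho setT| else #|fimage rho Z|)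
       = \prod_(j < m) #|if j \in J then fimage rho setT else fimage rho Z|)%N.
      by apply: eq_bigr => j _; case: ifP.
    rewrite -card_family_prod subset_leq_card //.
    apply/fintype.subsetP => _ /fimageP[g Kg <-]; rewrite inE; apply/forallP => j.
    rewrite ffunE; case: ifP => [_|]; first exact: mem_fimage.
    rewrite inE => /asboolP/contrapT h; apply: mem_fimage; apply: h.
    by exists g.
  move=> i0i; have := subset_leq_card (fimage_family J fq nK).
  rewrite card_family_prod; set N := #|fimage (ffun_map rho) K| => le.
  apply: leq_trans (leq_mul (leqnn _) le).
  rewrite -prod_nat_const.
  rewrite [X in (_ <= _ * X)%N](bigID (fun j => j \in J)) /=.
  rewrite [X in (_ <= _ * (_ * X))%N]big1 ?muln1; last first.
    by move=> j /negPf ->; rewrite cards1.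
  rewrite -big_split /=; apply: leq_prod => j jJ; rewrite jJ.
  apply: ((CiP j).2 jJ i _ gT rho fq).
  exact: leq_trans (leq_bigmax (F := fun j => (Ci j).2) j) i0i.
Qed.
End NormalBounds.

(** * Limits inferior and intervals *)

Section Liminf.
Variable R : realType.
Local Open Scope classical_set_scope.
Local Open Scope ring_scope.
Implicit Types (u : nat -> R) (l : R).

Lemma bounded01 u : (forall i, 0 <= u i <= 1) -> bounded_fun (u : nat -> R^o).
Proof.
move=> u01; exists 1; split=> // M M1 i _ /=.
by have /andP[u0 u1] := u01 i; rewrite ger0_norm // (le_trans u1) // ltW.
Qed.

(** This and the next three lemmas give the epsilon form of [limn_inf]: lower bounds must hold
    eventually, upper bounds only infinitely often. The range of [u] supplies the boundedness that
    [limn_infE] asks for. *)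
Lemma le_limn_inf u l : (forall i, 0 <= u i <= 1) ->
  (forall e, 0 < e -> exists i0, forall i, (i0 <= i)%N -> l - e <= u i) -> l <= limn_inf u.
Proof.
move=> u01 h; rewrite limn_infE; last exact: bounded01.
apply/ler_addgt0Pr => e e0; have [i0 hi0] := h e e0.
rewrite -lerBlDr; apply: (@le_trans _ _ (infs u i0)).
  apply: lb_le_inf; first by exists (u i0); exists i0 => /=.
  by move=> _ [i /= i0i <-]; exact: hi0.
apply: ub_le_sup; last by exists i0.
exists 1 => _ [j _ <-]; apply: (@le_trans _ _ (u j)); last by have /andP[] := u01 j.
apply: ge_inf; last by exists j => /=.
by exists 0 => _ [i _ <-]; have /andP[] := u01 i.
Qed.

Lemma limn_inf_le u l : (forall i, 0 <= u i <= 1) ->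
  (forall e, 0 < e -> forall i0, exists2 i, (i0 <= i)%N & u i <= l + e) -> limn_inf u <= l.
Proof.
move=> u01 h; rewrite limn_infE; last exact: bounded01.
apply/ler_addgt0Pr => e e0; apply: ge_sup; first by exists (infs u 0%N); exists 0%N.
move=> _ [i0 _ <-]; have [i i0i ui] := h e e0 i0.
apply: le_trans ui; apply: ge_inf; last by exists i.
by exists 0 => _ [j _ <-]; have /andP[] := u01 j.
Qed.

Lemma limn_inf_eventually u : (forall i, 0 <= u i <= 1) ->
  forall e, 0 < e -> exists i0, forall i, (i0 <= i)%N -> limn_inf u - e <= u i.
Proof.
move=> u01 e e0; apply: contrapT => /forallNP h.
suff : limn_inf u <= limn_inf u - e by rewrite lerBrDr gerDl leNgt e0.
apply: limn_inf_le => // e' e'0 i0.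
have /existsNP[i /not_implyP[i0i /negP]] := h i0; rewrite -ltNge => lt.
by exists i => //; rewrite (le_trans (ltW lt)) // lerDl ltW.
Qed.

Lemma limn_inf_frequently u : (forall i, 0 <= u i <= 1) ->
  forall e, 0 < e -> forall i0, exists2 i, (i0 <= i)%N & u i <= limn_inf u + e.
Proof.
move=> u01 e e0 i0; apply: contrapT => h.
suff : limn_inf u + e <= limn_inf u by rewrite gerDl leNgt e0.
apply: le_limn_inf => // e' e'0; exists i0 => i i0i.
have [le|lt] := leP (u i) (limn_inf u + e); first by case: h; exists i.
by rewrite (le_trans _ (ltW lt)) // gerBl ltW.
Qed.
End Liminf.

(** * The intervals of the spectrum *)

Section Intervals.
Variables (R : realType) (m n : nat).
Hypotheses (hm : (maxn 2 (n - 1) <= m)%N) (hn : (2 <= n)%N).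
Local Open Scope classical_set_scope.
Local Open Scope ring_scope.

(** The formula of [mid_interval], used here for all [l] up to [m]: the possible dimensions when [l]
    coordinates are not inside [Z]. The right end equals [l / m + (m - l) / (m n)], and for [l = m]
    the strip is the point 1. *)
Definition strip (l : nat) : set R :=
  `[l%:R / m%:R, (m%:R + l%:R * (n%:R - 1)) / (m%:R * n%:R)].

(* The [k]-th interval from the left; [k = 0] is the union of the [strip]s that
   overlap, the others are single strips. *)
Definition ordered_interval (k : nat) : set R :=
  `[(if k == 0%N then 0 else (m + 1 - n + k)%:R / m%:R),
    (m%:R + (m + 1 - n + k)%:R * (n%:R - 1)) / (m%:R * n%:R)].

Let m2 : (2 <= m)%N. Proof. by move: hm; rewrite geq_max => /andP[]. Qed.
Let nm : (n <= m + 1)%N. Proof. by move: hm; rewrite geq_max leq_subLR addnC => /andP[]. Qed.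
Let m0 : 0 < m%:R :> R. Proof. by rewrite ltr0n (leq_trans _ m2). Qed.
Let n0 : 0 < n%:R :> R. Proof. by rewrite ltr0n (leq_trans _ hn). Qed.
Let n1 : 1 <= n%:R :> R. Proof. by rewrite ler1n (leq_trans _ hn). Qed.

(** Without denominators the claim is [m + l (n - 1) < (l + 1) n], that is [m - l < n]. Hence
    [l = m + 1 - n] is the first strip separated from its successor. *)
Lemma strip_bound_ltS (l : nat) : (m < n + l)%N ->
  (m%:R + l%:R * (n%:R - 1)) / (m%:R * n%:R) < l.+1%:R / m%:R :> R.
Proof.
move=> h; rewrite ltr_pdivrMr ?mulr_gt0 // mulrA divfK ?gt_eqF //.
by move: h; rewrite -(ltr_nat R) natrD -natr1 => h; nra.
Qed.

Lemma strip_bound_leS (l : nat) : (n + l <= m)%N ->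
  l.+1%:R / m%:R <= (m%:R + l%:R * (n%:R - 1)) / (m%:R * n%:R) :> R.
Proof.
move=> h; rewrite ler_pdivlMr ?mulr_gt0 // mulrA divfK ?gt_eqF //.
by move: h; rewrite -(ler_nat R) natrD -natr1 => h; nra.
Qed.

Lemma strip_le (l : nat) : (l <= m)%N ->
  l%:R / m%:R <= (m%:R + l%:R * (n%:R - 1)) / (m%:R * n%:R) :> R.
Proof.
move=> h; rewrite ler_pdivlMr ?mulr_gt0 // mulrA divfK ?gt_eqF //.
by move: h; rewrite -(ler_nat R) => h; nra.
Qed.

Lemma strip_bound_le (l l' : nat) : (l <= l')%N ->
  (m%:R + l%:R * (n%:R - 1)) / (m%:R * n%:R) <=
  (m%:R + l'%:R * (n%:R - 1)) / (m%:R * n%:R) :> R.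
Proof.
move=> h; rewrite ler_pM2r ?invr_gt0 ?mulr_gt0 // lerD2l ler_wpM2r ?ler_nat //.
by rewrite subr_ge0.
Qed.

(** The numerator [m n - (n - 1)^2] is the right end of the strip [m + 1 - n], the last one of the
    overlapping chain. The truncated subtraction is exact because [n <= m + 1]. *)
Lemma low_intervalE : low_interval R m n = ordered_interval 0.
Proof.
rewrite /low_interval /ordered_interval eqxx addn0 natrB // natrD.
suff -> : m%:R * n%:R - (n%:R - 1) ^+ 2 =
  m%:R + (m%:R + 1%:R - n%:R) * (n%:R - 1) :> R by [].
ring.
Qed.

Lemma mid_intervalE (k : nat) : (0 < k)%N ->
  mid_interval R m n (m + 1 - n + k) = ordered_interval k.
Proof. by rewrite /ordered_interval; case: k. Qed.

Lemma last_intervalE : [set 1] = ordered_interval (n - 1).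
Proof.
rewrite /ordered_interval ifF; last by apply/eqP; lia.
have -> : (m + 1 - n + (n - 1) = m)%N by lia.
have -> : (m%:R + m%:R * (n%:R - 1)) / (m%:R * n%:R) = 1 :> R.
  by field; rewrite !gt_eqF.
by rewrite divff ?gt_eqF // set_itv1.
Qed.

Lemma interval_familyE : interval_family R m n = ordered_interval @` `I_n.
Proof.
rewrite /interval_family; apply/seteqP; split=> [I [[->|[l /andP[l1 l2] <-]]|->]|_ [k kn <-]].
- by exists 0%N => //=; [lia|rewrite low_intervalE].
- exists (l - (m + 1 - n))%N; first by rewrite /=; lia.
  rewrite -mid_intervalE; last lia.
  by congr (mid_interval R m n _); lia.
- by exists (n - 1)%N; [rewrite /=; lia|rewrite last_intervalE].
move: kn; rewrite /= => kn; have [->|k0] := posnP k.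
  by left; left; rewrite low_intervalE.
have [k1|k1] := ltnP k (n - 1).
  left; right; exists (m + 1 - n + k)%N; last by rewrite mid_intervalE.
  by rewrite /mid_range /=; apply/andP; split; lia.
by right; rewrite last_intervalE; congr (ordered_interval _); lia.
Qed.

Lemma ordered_interval_neq0 (k : nat) : (k < n)%N -> ordered_interval k !=set0.
Proof.
move=> kn; exists ((m%:R + (m + 1 - n + k)%:R * (n%:R - 1)) / (m%:R * n%:R)).
rewrite /ordered_interval /= in_itv /= lexx andbT.
have s : (m + 1 - n + k)%:R / m%:R <=
  (m%:R + (m + 1 - n + k)%:R * (n%:R - 1)) / (m%:R * n%:R) :> R.
  by apply: strip_le; lia.
by case: eqP => // _; apply: le_trans s; rewrite divr_ge0.
Qed.

Lemma ordered_interval_lt (j k : nat) (v w : R) : (j < k)%N ->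
  ordered_interval j v -> ordered_interval k w -> v < w.
Proof.
move=> jk; rewrite /ordered_interval /= !in_itv /= => /andP[_ vj] /andP[kw _].
apply: le_lt_trans vj _; apply: lt_le_trans kw.
have -> : (k == 0%N) = false by case: k jk.
apply: lt_le_trans (strip_bound_ltS _) _; first lia.
by rewrite ler_pM2r ?invr_gt0 // ler_nat; lia.
Qed.

Lemma ordered_interval_inj (j k : nat) : (j < n)%N -> (k < n)%N ->
  ordered_interval j `&` ordered_interval k !=set0 -> j = k.
Proof.
move=> jn kn [v [vj vk]]; have [jk|kj|//] := ltngtP j k.
  by have := ordered_interval_lt jk vj vk; rewrite ltxx.
by have := ordered_interval_lt kj vk vj; rewrite ltxx.
Qed.

(** The count is of distinct sets: two equal members would meet, as each is nonempty. *)
Lemma interval_family_card : (interval_family R m n #= `I_n)%card.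
Proof.
rewrite interval_familyE; apply: inj_card_eq => j k; rewrite !inE /= => jn kn e.
apply: ordered_interval_inj => //; rewrite e setIid.
exact: ordered_interval_neq0.
Qed.

Lemma interval_family_trivIset : trivIset (interval_family R m n) id.
Proof.
rewrite interval_familyE => _ _ [j jn <-] [k kn <-] /= h.
by rewrite (ordered_interval_inj jn kn h).
Qed.

Lemma interval_family_interval (I : set R) : interval_family R m n I ->
  is_interval I /\ I !=set0.
Proof.
rewrite interval_familyE => -[k kn <-]; split; last exact: ordered_interval_neq0.
exact: interval_is_interval.
Qed.

Lemma strip_unionE :
  low_interval R m n `|` \bigcup_(l in mid_range m n) mid_interval R m n l `|` [set 1]
  = \bigcup_(l in [set l | (l <= m)%N]) strip l.
Proof.
have last : strip m = [set 1].
  rewrite last_intervalE /ordered_interval ifF; last by apply/eqP; lia.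
  by have -> : (m + 1 - n + (n - 1) = m)%N by lia.
apply/seteqP; split=> [v [[|[l /andP[l1 l2] vl]]|->]|v [l /= lm vl]].
- rewrite low_intervalE /ordered_interval eqxx addn0 /= in_itv /= => /andP[v0 v1].
  (* [v] lies between [k / m] and [(k + 1) / m]. Either strip [k] reaches [(k + 1) / m] and contains
     [v], or [k] is at least [m + 1 - n] and strip [m + 1 - n] contains [v]. *)
  pose k := Num.truncn (v * m%:R).
  have /andP[k1 k2] := truncn_itv (mulr_ge0 v0 (ltW m0)).
  have kv : k%:R / m%:R <= v by rewrite ler_pdivrMr.
  have vk : v < k.+1%:R / m%:R by rewrite ltr_pdivlMr.
  have [le|lt] := leqP (n + k) m.
    exists k; first by rewrite /=; lia.
    rewrite /strip /= in_itv /= kv /=; apply: le_trans (ltW vk) _.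
    exact: strip_bound_leS.
  exists (m + 1 - n)%N; first by rewrite /=; lia.
  rewrite /strip /= in_itv /= v1 andbT; apply: le_trans kv.
  by rewrite ler_pM2r ?invr_gt0 // ler_nat; lia.
- by exists l => //=; lia.
- by exists m => //=; rewrite last.
have [l1|l1] := leqP l (m + 1 - n).
  left; left; rewrite low_intervalE /ordered_interval eqxx addn0 /= in_itv /=.
  move: vl; rewrite /strip /= in_itv /= => /andP[vl1 vl2].
  rewrite (le_trans _ vl1) ?divr_ge0 //=.
  exact: le_trans vl2 (strip_bound_le l1).
have [l2|l2] := ltnP l m.
  left; right; exists l => //.
  by rewrite /mid_range /=; apply/andP; split; lia.
have e : l = m by apply/eqP; rewrite eqn_leq lm l2.
by right; move: vl; rewrite e last.
Qed.
End Intervals.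

(** * The normal Hausdorff spectrum *)

Section Logarithm.
Variables (R : realType) (p : nat).
Hypothesis p_prime : prime p.
Local Open Scope ring_scope.

Lemma ln_prime_gt0 : 0 < ln p%:R :> R.
Proof. by rewrite ln_gt0 // ltr1n prime_gt1. Qed.

Lemma logpX (k : nat) : logp p (p ^ k)%N%:R = k%:R :> R.
Proof.
rewrite /logp natrX lnXn ?ltr0n ?prime_gt0 // -[ln _ *+ k]mulr_natl mulfK //.
by rewrite gt_eqF // ln_prime_gt0.
Qed.

Lemma logp_le (a b : nat) : (0 < a)%N -> (a <= b)%N -> logp p a%:R <= logp p b%:R :> R.
Proof.
move=> a0 ab; rewrite ler_pM2r ?invr_gt0 ?ln_prime_gt0 //.
by rewrite ler_ln ?posrE ?ltr0n ?ler_nat // (leq_trans a0).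
Qed.

Lemma logp_ge0 (a : nat) : 0 <= logp p a%:R :> R.
Proof.
case: a => [|a]; first by rewrite /logp ln0 ?mul0r.
by apply: le_trans (@logp_le 1 a.+1 _ _) => //; rewrite /logp ln1 mul0r.
Qed.

Lemma logpM (a b : nat) : (0 < a)%N -> (0 < b)%N ->
  logp p (a * b)%N%:R = logp p a%:R + logp p b%:R :> R.
Proof. by move=> a0 b0; rewrite /logp natrM lnM ?posrE ?ltr0n // mulrDl. Qed.

Lemma logp_exp (a k : nat) : (0 < a)%N -> logp p (a ^ k)%N%:R = k%:R * logp p a%:R :> R.
Proof. by move=> a0; rewrite /logp natrX lnXn ?ltr0n // -[ln _ *+ k]mulr_natl mulrA. Qed.

Lemma logp_ratio01 (a b : nat) : (0 < a)%N -> (a <= b)%N ->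
  0 <= (logp p a%:R / logp p b%:R : R) <= 1.
Proof.
move=> a0 ab; rewrite divr_ge0 ?logp_ge0 //=.
have := logp_ge0 b; rewrite le_eqVlt => /orP[/eqP <-|b0].
  by rewrite invr0 mulr0.
by rewrite ler_pdivrMr // mul1r logp_le.
Qed.
End Logarithm.

Section Spectrum.
Local Open Scope classical_set_scope.
Variables (R : realType) (p : nat) (G : topologicalGroupType) (x y : G) (Z H : set G).
Variables (tau : forall k, G -> 'Z_(p ^ k.+1)) (V : nat -> set G).
Hypotheses (p_prime : prime p) (cov : central_wreath_cover x y Z tau V).
Hypothesis sHB : H `<=` base_set tau.
Variables (m n : nat) (S : nat -> set G).
Hypotheses (m_gt0 : (0 < m)%N) (n_gt0 : (0 < n)%N).
Hypothesis fS : filtration_series S.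
Hypotheses (H1 : H 1%g) (hdim_H : hdim R p S H = 1%R) (hdim_Z : hdim R p S Z = (n%:R^-1)%R).

Lemma index_exp (A : set G) (i : nat) : is_subgroup A ->
  exists a, Defs.index A (S i) = (p ^ a)%N.
Proof.
move=> sA; have [_ _ /(_ i)[oi ni] _] := fS.
have [gT [rho fq]] := cwc_quotient cov oi ni.
rewrite (index_fimage _ fq ni.1).
have : (p.-group (img fq sA))%g by apply: pgroupS (fqm_pgroup fq); exact: finset.subsetT.
by case/p_natP => a ->; exists a.
Qed.

Lemma index_le (A B : set G) (i : nat) : A `<=` B ->
  (Defs.index A (S i) <= Defs.index B (S i))%N.
Proof.
move=> sAB; have [_ _ /(_ i)[oi ni] _] := fS.
have [gT [rho fq]] := cwc_quotient cov oi ni.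
by rewrite !(index_fimage _ fq ni.1) subset_leq_card // fimageS.
Qed.

Lemma index_gt0 (A : set G) (i : nat) : A 1%g -> (0 < Defs.index A (S i))%N.
Proof.
move=> A1; have [_ _ /(_ i)[oi ni] _] := fS.
have [gT [rho fq]] := cwc_quotient cov oi ni.
rewrite (index_fimage _ fq ni.1); apply/card_gt0P; exists (rho 1%g).
exact: mem_fimage.
Qed.

(** Once [S i] lies in [V N], the image of [x] has order divisible by [p ^ N.+1]. The growth of the
    index absorbs multiplicative constants and rounding errors in the dimension. *)
Lemma index_setT_ge (N : nat) : exists i0, forall i, (i0 <= i)%N ->
  (p ^ N <= Defs.index setT (S i))%N.
Proof.
have [oV nV] := cwc_open cov N.
have [i0 h] := filtration_eventually (cwc_compact cov) fS oV (subgroup1 nV.1).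
exists i0 => i i0i; have [_ _ /(_ i)[oi ni] _] := fS.
have [gT [rho fq]] := cwc_quotient cov oi ni.
rewrite (index_fimage _ fq ni.1).
have -> : fimage rho setT = [set: gT]%SET.
  by apply/setP => z; rewrite [RHS]inE; have [g <-] := fqm_onto fq z; exact: mem_fimage.
apply: dvdn_leq; first exact: cardG_gt0.
apply: dvdn_trans (order_dvdG (finset.in_setT (rho x))).
apply: (@dvdn_trans (p ^ N.+1)); first by rewrite dvdn_exp2l.
apply: (cwc_Vx cov); apply: (h i i0i); apply/(fqm_ker fq).
by rewrite (morphgX _ (fqm_morph fq)) expg_order.
Qed.

Local Open Scope ring_scope.
Let T i := Defs.index setT (S i).
Let z i : R := logp p (Defs.index Z (S i))%:R / logp p (T i)%:R.
Let b i : R := logp p (Defs.index (base_set tau) (S i))%:R / logp p (T i)%:R.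

Let T0 i : (0 < T i)%N. Proof. exact: index_gt0. Qed.
Let Z0 i : (0 < Defs.index Z (S i))%N.
Proof. by apply: index_gt0; exact: subgroup1 (cwc_subgroup cov). Qed.
Let B0 i : (0 < Defs.index (base_set tau) (S i))%N.
Proof. by apply: index_gt0 => k; exact: tau1 cov k. Qed.

Lemma logT_unbounded (M : R) : exists i0, forall i, (i0 <= i)%N -> M <= logp p (T i)%:R.
Proof.
have [i0 h] := index_setT_ge (Num.trunc `|M|).+1.
exists i0 => i i0i; apply: le_trans (logp_le R p_prime _ (h i i0i)).
  rewrite logpX //; apply: le_trans (ler_norm M) _; apply: ltW.
  by have /andP[] := truncn_itv (normr_ge0 M).
by rewrite expn_gt0 prime_gt0.
Qed.

Let z01 i : 0 <= z i <= 1.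
Proof. by apply: logp_ratio01 => //; exact: index_le. Qed.

Lemma limn_inf_z : limn_inf z = n%:R^-1.
Proof.
rewrite -hdim_Z /hdim; congr (limn_inf _); apply/funext => i.
by rewrite index_setmul //; have [_ _ /(_ i)[_ []]] := fS.
Qed.

Lemma base_ratio (e : R) : 0 < e -> exists i0, forall i, (i0 <= i)%N -> 1 - e <= b i.
Proof.
move=> e0; pose u i : R := logp p (Defs.index H (S i))%:R / logp p (T i)%:R.
have u01 i : 0 <= u i <= 1 by apply: logp_ratio01 => //; [exact: index_gt0|exact: index_le].
have <- : limn_inf u = 1.
  rewrite -hdim_H /hdim; congr (limn_inf _); apply/funext => i.
  by rewrite index_setmul //; have [_ _ /(_ i)[_ []]] := fS.
have [i0 h] := limn_inf_eventually u01 e0; exists i0 => i i0i.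
apply: le_trans (h i i0i) _; rewrite ler_wpM2r ?invr_ge0 ?logp_ge0 //.
by apply: logp_le => //; [exact: index_gt0|exact: index_le].
Qed.

Let pow_ratio (K : set (gpow G m)) i : R :=
  logp p (Defs.index (setmul K (filtration_pow S m i)) (filtration_pow S m i))%:R
  / logp p (Defs.index setT (filtration_pow S m i))%:R.

Lemma pow_index (K : set (gpow G m)) i : K 1%g ->
  [/\ Defs.index setT (filtration_pow S m i) = (T i ^ m)%N,
    (0 < Defs.index (setmul K (filtration_pow S m i)) (filtration_pow S m i))%N &
    (Defs.index (setmul K (filtration_pow S m i)) (filtration_pow S m i) <= T i ^ m)%N].
Proof.
move=> K1; have [_ _ /(_ i)[oi ni] _] := fS.
have [gT [rho fq]] := cwc_quotient cov oi ni.
have E := index_pow_setT m fS fq.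
split => //; rewrite (index_pow fS K fq).
  by apply/card_gt0P; exists (ffun_map rho 1%g); exact: mem_fimage.
rewrite (index_fimage _ fq ni.1 : T i = _).
have -> : fimage rho setT = [set: gT]%SET.
  by apply/setP => w; rewrite [RHS]inE; have [g <-] := fqm_onto fq w; exact: mem_fimage.
by rewrite cardsT -[m in (_ <= _ ^ m)%N]card_ord -card_ffun max_card.
Qed.

Let pow_ratioE (K : set (gpow G m)) i : K 1%g -> pow_ratio K i =
  logp p (Defs.index (setmul K (filtration_pow S m i)) (filtration_pow S m i))%:R
  / (m%:R * logp p (T i)%:R).
Proof. by move=> K1; have [e _ _] := pow_index i K1; rewrite /pow_ratio e logp_exp. Qed.

Let pow_ratio01 (K : set (gpow G m)) i : K 1%g -> 0 <= pow_ratio K i <= 1.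
Proof. by move=> K1; have [e h1 h2] := pow_index i K1; apply: logp_ratio01; rewrite ?e. Qed.

Let m0 : 0 < m%:R :> R. Proof. by rewrite ltr0n. Qed.
Let n0 : 0 < n%:R :> R. Proof. by rewrite ltr0n. Qed.

Lemma hdim_normal_strip (K : set (gpow G m)) : is_normal K ->
  exists2 l, (l <= m)%N & @strip R m n l (hdim R p (filtration_pow S m) K).
Proof.
move=> nK; have K1 := subgroup1 nK.1.
have [l [C [i0 [lm C0 h]]]] := normal_index_bounds p_prime cov fS nK.
exists l => //; rewrite /strip /= in_itv /=.
have lm' : l%:R <= m%:R :> R by rewrite ler_nat.
have r01 i : 0 <= pow_ratio K i <= 1 by exact: pow_ratio01.
rewrite -[hdim R p _ K]/(limn_inf (pow_ratio K)); apply/andP; split.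
- apply: le_limn_inf => // e e0.
  have e2 : 0 < e / 2 by rewrite divr_gt0.
  have [i1 h1] := base_ratio e2.
  (* The 1 keeps the logarithm of the index positive; the other bound makes the logarithm of [C] at
     most [e / 2] times it. *)
  have [i2 h2] := logT_unbounded (Num.max 1 (logp p C%:R / (e / 2))).
  exists (maxn i0 (maxn i1 i2)) => i; rewrite !geq_max => /and3P[i0i i1i i2i].
  have [_ N0 _] := pow_index i K1.
  have := h2 i i2i; rewrite ge_max => /andP[t1 tC].
  have t0 : 0 < logp p (T i)%:R :> R by rewrite (lt_le_trans ltr01).
  have {}h1 := h1 i i1i; rewrite /b ler_pdivlMr // in h1.
  rewrite ler_pdivrMr // in tC.
  have hB := (h i).2 i0i.
  have : l%:R * logp p (Defs.index (base_set tau) (S i))%:R <= logp p C%:R +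
      logp p (Defs.index (setmul K (filtration_pow S m i)) (filtration_pow S m i))%:R :> R.
    by rewrite -logp_exp // -logpM //; apply: logp_le => //; rewrite expn_gt0 B0.
  have mt0 := mulr_gt0 m0 t0.
  rewrite pow_ratioE // ler_pdivlMr //.
  have -> : (l%:R / m%:R - e) * (m%:R * logp p (T i)%:R) =
      l%:R * logp p (T i)%:R - m%:R * (e * logp p (T i)%:R) :> R.
    by field; rewrite gt_eqF.
  have lB := ler_wpM2l (ler0n R l) h1.
  have m1 : 1 <= m%:R :> R by rewrite ler1n.
  (* The [l] base factors and [C] each lose [e / 2]; this total must not exceed the allowance
     [m e]. *)
  have lm1 : l%:R + 1 <= 2 * m%:R :> R by lra.
  have := ler_wpM2r (ltW (mulr_gt0 e2 t0)) lm1.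
  move: lB tC; move: (logp p (T i)%:R) (logp p C%:R) => L D.
  move: (logp p _) (logp p _) => NB NK; lra.
- have -> : (m%:R + l%:R * (n%:R - 1)) / (m%:R * n%:R) =
      l%:R / m%:R + (m%:R - l%:R) / m%:R * n%:R^-1 :> R.
    by field; rewrite !gt_eqF.
  have c0 : 0 <= (m%:R - l%:R) / m%:R :> R by rewrite divr_ge0 // subr_ge0.
  have c1 : (m%:R - l%:R) / m%:R <= 1 :> R.
    by rewrite ler_pdivrMr // mul1r gerBl.
  apply: limn_inf_le => // e e0 i1.
  (* The ratio for [Z] need only approach [1 / n] along a subsequence, which is enough for an upper
     bound on a limit inferior. *)
  have [i i1i zi] := limn_inf_frequently z01 e0 i1; exists i => //.
  rewrite limn_inf_z in zi.
  apply: (@le_trans _ _ (l%:R / m%:R + (m%:R - l%:R) / m%:R * z i)); last first.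
    by rewrite -addrA lerD2l; nra.
  rewrite pow_ratioE //; have := logp_ge0 R p_prime (T i); rewrite le_eqVlt => /orP[/eqP t0|t0].
    (* A zero logarithm means a trivial quotient, where the ratio is a division by zero and hence
       0. *)
    rewrite -t0 mulr0 invr0 mulr0; apply: addr_ge0; first exact: divr_ge0.
    by apply: mulr_ge0 => //; have /andP[] := z01 i.
  have [_ N0 _] := pow_index i K1.
  have le : logp p (Defs.index (setmul K (filtration_pow S m i)) (filtration_pow S m i))%:R <=
      l%:R * logp p (T i)%:R + (m%:R - l%:R) * logp p (Defs.index Z (S i))%:R :> R.
    rewrite -natrB // -!logp_exp // -logpM ?expn_gt0 ?T0 ?Z0 //; apply: logp_le => //.
    exact: (h i).1.
  have mt0 := mulr_gt0 m0 t0.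
  rewrite ler_pdivrMr // /z; apply: le_trans le _.
  by rewrite le_eqVlt; apply/orP; left; apply/eqP; field; rewrite !gt_eqF.
Qed.

Lemma box_hdim (l : nat) (c : R) : (l <= m)%N -> 0 <= c <= 1 ->
  hspec_normal R p (filtration_pow S m) (l%:R / m%:R + (m%:R - l%:R) / m%:R * (c / n%:R)).
Proof.
move=> lm /andP[c0 c1]; have [S0 dS oS _] := fS; have sZ := cwc_subgroup cov.
have [d dE] := choice (fun i => index_exp i sZ).
have p1 := prime_gt1 p_prime.
have d0 : d 0%N = 0%N.
  apply/eqP; rewrite -(eqn_exp2l _ _ p1) expn0 -dE S0.
  have sT : is_subgroup [set: G] by [].
  rewrite (card_fimage_index (f := fun=> tt) _ sT) //.
  rewrite (_ : fimage _ _ = [set tt]%SET) ?cards1 //; apply/setP => -[].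
  rewrite [RHS]inE eqxx; apply/fimageP; exists 1%g => //.
  exact: subgroup1 sZ.
have dS' i : (d i <= d i.+1)%N.
  have [oi ni] := oS i; have [oi1 ni1] := oS i.+1.
  have [gT [rho fq]] := cwc_quotient cov oi1 ni1.
  rewrite -(leq_exp2l _ _ p1) -!dE [leqRHS](index_fimage _ fq ni1.1).
  rewrite -(index_mul_fimage fq ni (dS i) sZ) leq_pmulr //.
  apply/card_gt0P; exists (rho 1%g); apply: mem_fimage; split; first exact: subgroup1.
  exact: subgroup1 ni.1.
pose f i := Num.trunc (c * (d i)%:R).
have fI i : (f i)%:R <= c * (d i)%:R < (f i).+1%:R.
  exact: truncn_itv (mulr_ge0 c0 (ler0n _ _)).
(* Because [c <= 1], the difference [(1 - c) * d i] does not decrease, so the floor of [c * d i]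
   grows no faster than [d i]. *)
have fd i : (f i <= f i.+1 <= f i + (d i.+1 - d i))%N.
  have /andP[a1 a2] := fI i; have /andP[b1 b2] := fI i.+1.
  have dd : (d i)%:R <= (d i.+1)%:R :> R by rewrite ler_nat.
  apply/andP; split; rewrite -ltnS -(ltr_nat R).
    by apply: le_lt_trans a1 _; apply: le_lt_trans b2; rewrite ler_wpM2l.
  rewrite -addSn natrD natrB //; apply: le_lt_trans b1 _.
  have : (1 - c) * (d i)%:R <= (1 - c) * (d i.+1)%:R by rewrite ler_wpM2l // subr_ge0.
  lra.
have f0 : f 0%N = 0%N by rewrite /f d0 mulr0 truncn0.
have [L [sL cL LZ LE]] := central_subgroup_exists p_prime cov fS dE f0 fd.
have nL : is_normal L.
  by split=> // a g La; rewrite /conjg (cwc_central cov g (LZ a La)) mulKg.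
have nK := @box_normal G m l L nL; have K1 := subgroup1 nK.1.
exists (box l L); first by split=> //; exact: box_closed.
rewrite -[hdim R p _ _]/(limn_inf (pow_ratio (box l L))).
have r01 i : 0 <= pow_ratio (box l L) i <= 1 by exact: pow_ratio01.
have w0 : 0 <= (m%:R - l%:R) / m%:R :> R by rewrite divr_ge0 // subr_ge0 ler_nat.
have w1 : (m%:R - l%:R) / m%:R <= 1 :> R by rewrite ler_pdivrMr // mul1r gerBl.
set w := (m%:R - l%:R) / m%:R in w0 w1 *.
have rE i : 0 < logp p (T i)%:R :> R ->
    pow_ratio (box l L) i = l%:R / m%:R + w * ((f i)%:R / logp p (T i)%:R).
  move=> t0; have [oi ni] := oS i; have [gT [rho fq]] := cwc_quotient cov oi ni.
  rewrite pow_ratioE // (index_box fS fq lm (subgroup1 sL)) LE.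
  rewrite -expnM logpM ?expn_gt0 ?T0 ?prime_gt0 // logp_exp ?T0 // logpX //.
  by rewrite natrM natrB // /w; field; rewrite !gt_eqF.
have zE i : z i = (d i)%:R / logp p (T i)%:R by rewrite /z dE logpX.
apply/eqP; rewrite eq_le; apply/andP; split.
- apply: limn_inf_le => // e e0 i0.
  have [i1 h1] := logT_unbounded 1.
  have [i] := limn_inf_frequently z01 e0 (maxn i0 i1).
  rewrite geq_max => /andP[i0i i1i]; rewrite limn_inf_z zE => zi; exists i => //.
  have t0 : 0 < logp p (T i)%:R :> R by rewrite (lt_le_trans ltr01) // h1.
  rewrite rE // -addrA lerD2l.
  have q : (f i)%:R / logp p (T i)%:R <= c * (n%:R^-1 + e) :> R.
    apply: le_trans (ler_wpM2l c0 zi); rewrite mulrA ler_pM2r ?invr_gt0 //.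
    by have /andP[] := fI i.
  apply: le_trans (ler_wpM2l w0 q) _; rewrite mulrDr mulrDr lerD2l mulrA.
  by rewrite ler_piMl ?(ltW e0) // mulr_ile1.
- apply: le_limn_inf => // e e0; have e2 : 0 < e / 2 by rewrite divr_gt0.
  have [i1 h1] := limn_inf_eventually z01 e2.
  (* Rounding [c * d i] down costs less than 1, hence at most [e / 2] after division by the
     logarithm of the index. *)
  have [i2 h2] := logT_unbounded (Num.max 1 ((e / 2)^-1)).
  exists (maxn i1 i2) => i; rewrite geq_max => /andP[i1i i2i].
  have := h2 i i2i; rewrite ge_max => /andP[t1 te].
  have t0 : 0 < logp p (T i)%:R :> R by rewrite (lt_le_trans ltr01).
  have := h1 i i1i; rewrite limn_inf_z zE => zi.
  rewrite rE // -addrA lerD2l.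
  have ti : (logp p (T i)%:R)^-1 <= e / 2 :> R by rewrite invf_ple ?posrE.
  have q : c * n%:R^-1 - e <= (f i)%:R / logp p (T i)%:R :> R.
    have h3 : (c * (d i)%:R - 1) / logp p (T i)%:R <= (f i)%:R / logp p (T i)%:R :> R.
      rewrite ler_pM2r ?invr_gt0 // lerBlDr natr1 ltW //.
      by have /andP[] := fI i.
    apply: le_trans h3; rewrite mulrBl mul1r -mulrA.
    have := ler_wpM2l c0 zi; rewrite mulrBr => h4.
    have h5 : c * (e / 2) <= e / 2 by rewrite ler_piMl // ltW.
    lra.
  apply: le_trans (ler_wpM2l w0 q); rewrite mulrBr lerB //.
  by rewrite ler_piMl // ltW.
Qed.
End Spectrum.

Local Open Scope classical_set_scope.
Local Open Scope ring_scope.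

Theorem corollary4p5 (R : realType) (p m n : nat)
    (F : topologicalGroupType) (x y : F)
    (phi : F -> gprod (wreath_tower p))
    (G : topologicalGroupType) (q : F -> G)
    (S : nat -> set G)
    (p_prime : prime p) (p_odd : odd p)
    (hm : (maxn 2 (n - 1) <= m)%N) (hn : (2 <= n)%N)
    (F_free : free_pro_p2 p x y)
    (phi_hom : continuous_hom phi)
    (phi_epi : phi @` setT = W p)
    (phi_x : phi x = Wx p) (phi_y : phi y = Wy p)
    (q_quot : is_quotient (Nsub phi) q)
    (S_filt : filtration_series S)
    (hdim_H : hdim R p S (Hsub phi q) = 1)
    (hdim_Z : hdim R p S (Zsub phi q) = n%:R^-1) :
  [/\ hspec_normal R p (filtration_pow S m) =
        low_interval R m n
        `|` \bigcup_(l in mid_range m n) mid_interval R m n l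
        `|` [set 1],
      (interval_family R m n #= `I_n)%card,
      trivIset (interval_family R m n) id
    & forall I, interval_family R m n I -> is_interval I /\ I !=set0].
Proof.
have [tau [V [cov sH]]] := central_wreath_coverP p_prime F_free phi_hom phi_epi
  phi_x phi_y q_quot.
have m_gt0 : (0 < m)%N by move: hm; rewrite geq_max => /andP[m2 _]; exact: leq_trans m2.
have n_gt0 : (0 < n)%N by exact: leq_trans hn.
have sHB : Hsub phi q `<=` base_set tau by move=> g Hg k; exact: sH.
have H1 : Hsub phi q 1%g.
  have [qM _ _ _] := q_quot; have [_ phiM] := phi_hom.
  exists 1%g; last exact: morphg1.
  by rewrite /preimage /= morphg1 // => K [[K1 _] _ _].
split.
- rewrite strip_unionE //; apply/seteqP; split=> [_ [K [cK nK] <-]|v [l /= lm]].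
    by have [l lm hl] := hdim_normal_strip p_prime cov sHB m_gt0 n_gt0 S_filt H1
      hdim_H hdim_Z nK; exists l.
  have m0 : 0 < m%:R :> R by rewrite ltr0n.
  have n0 : 0 < n%:R :> R by rewrite ltr0n.
  rewrite /strip /= in_itv /= => /andP[v1 v2].
  have E : (m%:R + l%:R * (n%:R - 1)) / (m%:R * n%:R) =
      l%:R / m%:R + (m%:R - l%:R) / m%:R * (1 / n%:R) :> R.
    by field; rewrite !gt_eqF.
  have box (c : R) := box_hdim p_prime cov m_gt0 S_filt hdim_Z lm (c := c).
  have [lm1|ml] := ltnP l m.
    have d0 : 0 < m%:R - l%:R :> R by rewrite subr_gt0 ltr_nat.
    (* The solution of [v = l / m + (m - l) / m * (c / n)]; the end points of the strip correspond
       to [c = 0] and [c = 1]. *)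
    pose c := (v - l%:R / m%:R) * (m%:R * n%:R / (m%:R - l%:R)).
    have -> : v = l%:R / m%:R + (m%:R - l%:R) / m%:R * (c / n%:R).
      by rewrite /c; field; rewrite !gt_eqF.
    have k0 : 0 < m%:R * n%:R / (m%:R - l%:R) :> R by rewrite !(mulr_gt0, invr_gt0).
    apply: box; apply/andP; split; first by rewrite mulr_ge0 ?subr_ge0 // ltW.
    rewrite -ler_pdivlMr // lerBlDl; apply: le_trans v2 _; rewrite E lerD2l.
    by rewrite le_eqVlt; apply/orP; left; apply/eqP; field; rewrite !gt_eqF.
  have lE : l = m by apply/eqP; rewrite eqn_leq lm ml.
  (* For [l = m] the equation no longer determines [c]; the strip is a single point and any [c] will
     do. *)
  have -> : v = l%:R / m%:R + (m%:R - l%:R) / m%:R * (0 / n%:R).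
    apply/eqP; rewrite eq_le mul0r mulr0 addr0 v1 andbT.
    by move: v2; rewrite E lE subrr !mul0r addr0.
  by apply: box; rewrite lexx ler01.
- exact: interval_family_card.
- exact: interval_family_trivIset.
- by move=> I; exact: interval_family_interval.
Qed.
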